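(* Fix $\sigma,\tau>0$ and let $k=n\sigma(1-e^{-1/\sigma})$ and $l=n\tau(1-e^{-1/\tau})$. Then, as $n\to\infty$, $$m_{kl}(n)\sim\frac{n^{2n}}{n!}\,e^{n w(\sigma)}v(\sigma)\,e^{n w(\tau)}v(\tau)\,e^{-\frac{1}{2\sigma\tau}},$$ where $$w(x)=x(1-e^{-1/x})\log(1-e^{-1/x})+\log x-e^{-1/x},\qquad v(x)=\sqrt{\frac{x(1-e^{-1/x})}{x(1-e^{-1/x})-e^{-1/x}}}.$$
   Context: An incidence matrix is a zero-one matrix with no zero rows and no zero columns. For integers $k,l,n\ge0$, $m_{kl}(n)$ is the number of $k\times l$ incidence matrices with exactly $n$ ones. $a_n\sim b_n$ means $a_n/b_n\to1$. *)

(* Defs.v *)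
From HB Require Import structures.
From mathcomp Require Import all_boot all_order all_algebra.
From mathcomp Require Import all_classical all_reals all_analysis.

Set Implicit Arguments.
Unset Strict Implicit.
Unset Printing Implicit Defensive.

Import Order.TTheory GRing.Theory Num.Theory.
Import numFieldNormedType.Exports.

Local Open Scope ring_scope.

(* Zero-one matrices are represented by boolean matrices. *)
Definition incidence_mx (k l : nat) (M : 'M[bool]_(k, l)) : bool :=
  [forall i : 'I_k, exists j : 'I_l, M i j] &&
  [forall j : 'I_l, exists i : 'I_k, M i j].

Definition ones (k l : nat) (M : 'M[bool]_(k, l)) : nat :=
  #|[pred p : 'I_k * 'I_l | M p.1 p.2]|.

Definition num_incidence (k l n : nat) : nat :=
  #|[pred M : 'M[bool]_(k, l) | incidence_mx M && (ones M == n)]|.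

Section Constants.
Variable R : realType.
Implicit Types x : R.

Definition w x : R :=
  x * (1 - expR (- (1 / x))) * ln (1 - expR (- (1 / x)))
  + ln x - expR (- (1 / x)).

Definition v x : R :=
  Num.sqrt (x * (1 - expR (- (1 / x))) /
            (x * (1 - expR (- (1 / x))) - expR (- (1 / x)))).

End Constants.

(* Main.v *)
(** Write [r = 1 / sigma] and let [surj(m, k)] be the number of surjections from
    an [m]-set onto a [k]-set.  Inclusion-exclusion over the empty rows and
    columns, followed by the expansion of the falling factorial [(ab)^_n] in
    powers of [ab], gives
      [n! m_kl(n) = \sum_i (-1)^i c(n, n - i) surj(n - i, k) surj(n - i, l)]
    with [c] the unsigned Stirling numbers of the first kind.

    Up to the factor [r^m / m! / (e^r - 1)^k], the number [surj(m, k)] is the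
    probability that [k] independent Poisson([r]) variables conditioned to be
    positive sum up to [m].  The prescribed [k] makes [n] the mean of that sum,
    so Fourier inversion on the circle and Laplace's method give
    [surj(n - i, k) ~ (r / n)^i n^n e^(n w(sigma)) v(sigma)] for each fixed [i];
    the factor [n!] is handled by the same method applied to the Poisson law.

    Since [c(n, n - i) ~ n^(2i) / (2^i i!)], the [i]-th term of the sum, divided
    by the [0]-th one, tends to [(- 1 / (2 sigma tau))^i / i!].  The inequality
    [k^i surj(n - i, k) <= surj(n, k)] dominates the terms by those of an
    exponential series, so the sum of the limits is the limit of the sums. *)

Require Import Defs.
From HB Require Import structures.
From mathcomp Require Import all_boot all_order all_algebra.
From mathcomp Require Import all_classical all_reals all_analysis.
From mathcomp Require Import measurable_realfun complex.
From mathcomp Require Import zify ring lra.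

Set Implicit Arguments.
Unset Strict Implicit.
Unset Printing Implicit Defensive.

Import Order.TTheory GRing.Theory Num.Theory.
Import numFieldNormedType.Exports.

Local Open Scope ring_scope.
Local Notation Re := complex.Re.
Local Notation Im := complex.Im.

(** * Exact enumeration *)

(** The recursion chooses the image of one element of the domain; the other elements then cover the
    whole codomain or exactly miss that image. *)
Fixpoint num_surj (m k : nat) : nat :=
  match m, k with
  | 0, 0 => 1
  | m'.+1, k'.+1 => k'.+1 * (num_surj m' k'.+1 + num_surj m' k')
  | _, _ => 0
  end.

Lemma num_surjSS m k :
  num_surj m.+1 k.+1 = (k.+1 * (num_surj m k.+1 + num_surj m k))%N.
Proof. by []. Qed.

(** A surjection stays surjective whatever values it is given on [i] further points. This is the
    source of the dominating series at the end. *)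
Lemma num_surj_leX m k i : (k ^ i * num_surj m k <= num_surj (i + m) k)%N.
Proof.
elim: i => [|i IH]; first by rewrite expn0 mul1n.
rewrite addSn expnS -mulnA.
case: k IH => [|k] IH; first by rewrite mul0n.
by rewrite num_surjSS leq_mul2l /= (leq_trans IH) ?leq_addr.
Qed.

(** Inclusion-exclusion over the missed points, checked by induction on [m]: Pascal's rule and the
    absorption identity for binomials turn the alternating sum into the recursion of [num_surj]. *)
Lemma num_surjE (R : comNzRingType) m k : (num_surj m k)%:R =
  \sum_(j < k.+1) (-1) ^+ (k - j) * 'C(k, j)%:R * j%:R ^+ m :> R.
Proof.
elim: m k => [|m IH] k.
  transitivity ((- 1 + 1 : R) ^+ k).
    by rewrite addNr; case: k => [|k]; rewrite ?expr0 ?expr0n.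
  rewrite exprDn; apply: eq_bigr => j _.
  by rewrite expr1n mulr1 expr0 mulr1 mulr_natr.
case: k => [|k].
  by rewrite big_ord_recl big_ord0 /= expr0n /= mulr0 addr0.
rewrite num_surjSS natrM natrD !IH mulrDr !mulr_sumr.
(* A term with ['C(k, k.+1) = 0] is appended and one sign is extracted, so that both sums have the
   same range and the same powers of [-1]. *)
rewrite [X in _ + X](_ : _ = \sum_(j < k.+2)
  k.+1%:R * (- (-1) ^+ (k.+1 - j) * 'C(k, j)%:R * j%:R ^+ m)); last first.
  rewrite [RHS]big_ord_recr /= bin_small // mulr0 mul0r mulr0 addr0.
  apply: eq_bigr => j _; rewrite subSn ?exprS ?mulN1r ?opprK //.
  by rewrite -ltnS.
rewrite -big_split /=; apply: eq_bigr => -[[|j] /= jk] _.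
  by rewrite !bin0 !mulr1 mulNr mulrN subrr expr0n mulr0.
rewrite binS natrD.
have: (j.+1 * 'C(k.+1, j.+1) = k.+1 * 'C(k, j))%N by rewrite mul_bin_diag.
rewrite binS => /(congr1 (fun x : nat => x%:R : R)).
rewrite !natrM natrD (exprS j.+1%:R).
move=> e; apply/esym; transitivity ((-1) ^+ (k.+1 - j.+1) * j.+1%:R ^+ m *
   (j.+1%:R * ('C(k, j.+1)%:R + 'C(k, j)%:R)) : R); first by ring.
by rewrite e; ring.
Qed.

Lemma sum_card_sets (R : comNzRingType) k (F : nat -> R) :
  \sum_(A : {set 'I_k}) F #|A| = \sum_(j < k.+1) 'C(k, j)%:R * F j.
Proof.
have cardA (A : {set 'I_k}) : (#|A| < k.+1)%N.
  by rewrite ltnS -[X in (_ <= X)%N](card_ord k) max_card.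
rewrite (partition_big (fun A : {set 'I_k} => inord #|A| : 'I_k.+1) predT) //=.
apply: eq_bigr => j _.
rewrite (eq_bigl (fun A : {set 'I_k} => #|A| == j)); last first.
  by move=> A; rewrite -val_eqE /= inordK.
rewrite (eq_bigr (fun=> F j)) => [|A /eqP -> //].
rewrite sumr_const [RHS]mulr_natl; congr (F j *+ _).
by have := card_draws 'I_k j; rewrite card_ord cardsE.
Qed.

(** * Inclusion-exclusion over empty rows and columns *)

Section InclusionExclusion.
Variables (R : comNzRingType) (k l : nat).

(** The indicator is the product over the rows of one minus the indicator of an empty row. In its
    expansion [A] collects the rows where the factor 1 is chosen, so the rows outside [A] must be
    empty. *)
Lemma prod_exists_row (I J : finType) (M : I -> J -> bool) :
  ([forall i, exists j, M i j] : nat)%:R =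
  \sum_(A : {set I}) (-1) ^+ (#|I| - #|A|) *
    ([forall i, forall j, M i j ==> (i \in A)] : nat)%:R :> R.
Proof.
transitivity (\prod_(i : I) (1 + - ([forall j, ~~ M i j] : nat)%:R : R)).
  case: (boolP [forall i, _]) => [/forallP h|].
    rewrite big1 // => i _; case: forallP => [h'|_]; last by rewrite subr0.
    by have /existsP[j] := h i; rewrite (negbTE (h' j)).
  rewrite negb_forall => /existsP[x]; rewrite negb_exists => h.
  by rewrite (bigD1 x) //= h subrr mul0r.
rewrite bigA_distr; apply: eq_bigr => A _.
rewrite (eq_bigr (fun i => (if i \in A then 1 else -1) *
   ([forall j, M i j ==> (i \in A)] : nat)%:R)); last first.
  move=> i _; case: ifP => iA.
    by rewrite (_ : [forall j, _] = true) ?mulr1 //; apply/forallP => j; rewrite implybT.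
  by rewrite mulN1r; congr (- _%:R); congr nat_of_bool.
rewrite big_split /=; congr (_ * _).
  rewrite (eq_bigr (fun i => if i \in ~: A then -1 else 1)).
    by rewrite -big_mkcond /= prodr_const cardsCs finset.setCK.
  by move=> i _; rewrite inE; case: ifP.
case: (boolP [forall i, _]) => [/forallP h|].
  by rewrite big1 // => i _; rewrite h.
rewrite negb_forall => /existsP[i /negbTE h].
by rewrite (bigD1 i) //= h mul0r.
Qed.

(** A matrix is identified with the set [S] of its cells equal to one. Requiring rows outside [A]
    and columns outside [B] to be empty means that [S] lies in [A] times [B], which leaves a count
    of [n]-subsets. *)
Lemma num_incidence_sets n : (num_incidence k l n)%:R =
  \sum_(A : {set 'I_k}) \sum_(B : {set 'I_l})
    (-1) ^+ (k - #|A|) * (-1) ^+ (l - #|B|) * 'C(#|A| * #|B|, n)%:R :> R.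
Proof.
pose f (S : {set 'I_k * 'I_l}) : 'M[bool]_(k, l) := \matrix_(i, j) ((i, j) \in S).
have fbij : bijective f.
  exists (fun M : 'M[bool]_(k, l) => [set p : 'I_k * 'I_l | M p.1 p.2]) => [S|M].
    by apply/setP => -[i j]; rewrite inE mxE.
  by apply/matrixP => i j; rewrite mxE inE.
rewrite /num_incidence -sum1_card natr_sum big_mkcond /=.
rewrite (reindex f) /=; last exact: onW_bij.
transitivity (\sum_(S : {set 'I_k * 'I_l}) \sum_(A : {set 'I_k})
   \sum_(B : {set 'I_l}) (-1) ^+ (k - #|A|) * (-1) ^+ (l - #|B|) *
    (((S \subset finset.setX A B) && (#|S| == n)) : nat)%:R : R).
  apply: eq_bigr => S _; rewrite inE /incidence_mx.
  have -> : ones (f S) = #|S|.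
    by apply: eq_card => -[i j]; rewrite !inE mxE.
  transitivity (([forall i, exists j, f S i j] : nat)%:R *
    ([forall j, exists i, f S i j] : nat)%:R * ((#|S| == n) : nat)%:R : R).
    by do 2 case: [forall _, _]; case: eqP; rewrite ?mul1r ?mul0r ?mulr0.
  rewrite (prod_exists_row (f S)).
  rewrite (prod_exists_row (fun j i => f S i j)) !card_ord.
  rewrite big_distrlr /= mulr_suml; apply: eq_bigr => A _.
  rewrite mulr_suml; apply: eq_bigr => B _.
  rewrite mulrACA -!mulrA; congr (_ * (_ * _)).
  rewrite mulrA -!natrM !mulnb; congr (nat_of_bool (_ && _))%:R.
  apply/andP/fintype.subsetP => [[/forallP h1 /forallP h2] [i j] ijS|h].
    rewrite finset.in_setX /=; apply/andP; split.
      by have /forallP/(_ j) := h1 i; rewrite mxE ijS.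
    by have /forallP/(_ i) := h2 j; rewrite mxE ijS.
  split; apply/forallP => i; apply/forallP => j; apply/implyP; rewrite mxE.
    by move/h; rewrite finset.in_setX => /andP[].
  by move/h; rewrite finset.in_setX => /andP[].
rewrite exchange_big /=; apply: eq_bigr => A _.
rewrite exchange_big /=; apply: eq_bigr => B _.
rewrite -mulr_sumr; congr (_ * _).
rewrite -natr_sum -cardsX -cards_draws -sum1_card [in RHS]big_mkcond /=.
by congr _%:R; apply: eq_bigr => S _; rewrite inE; case: (_ && _).
Qed.

Lemma num_incidence_binomials n : (num_incidence k l n)%:R =
  \sum_(i < k.+1) \sum_(j < l.+1)
    ((-1) ^+ (k - i) * 'C(k, i)%:R) * ((-1) ^+ (l - j) * 'C(l, j)%:R)
    * 'C(i * j, n)%:R :> R.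
Proof.
rewrite num_incidence_sets.
rewrite (sum_card_sets k (fun a => \sum_(B : {set 'I_l})
  (-1) ^+ (k - a) * (-1) ^+ (l - #|B|) * 'C(a * #|B|, n)%:R)).
apply: eq_bigr => i _; rewrite (sum_card_sets l (fun b =>
  (-1) ^+ (k - i) * (-1) ^+ (l - b) * 'C(i * b, n)%:R)) mulr_sumr.
by apply: eq_bigr => j _; ring.
Qed.

End InclusionExclusion.

(* [stirling1 n i] is the unsigned Stirling number of the first kind
   [c(n, n - i)]. *)
Fixpoint stirling1 (n i : nat) : nat :=
  match n, i with
  | _, 0 => 1
  | 0, _.+1 => 0
  | n'.+1, i'.+1 => stirling1 n' i'.+1 + n' * stirling1 n' i'
  end.

Lemma stirling1n0 n : stirling1 n 0 = 1%N. Proof. by case: n. Qed.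

Lemma stirling1SS n i :
  stirling1 n.+1 i.+1 = (stirling1 n i.+1 + n * stirling1 n i)%N.
Proof. by []. Qed.

Lemma stirling1_small n i : (n <= i)%N -> (0 < i)%N -> stirling1 n i = 0%N.
Proof.
elim: n i => [|n IH] [|i] //; rewrite ltnS => ni _.
rewrite stirling1SS IH ?(leq_trans ni) // add0n.
by case: n IH ni => [|n] IH ni //; rewrite IH ?muln0 // (leq_trans _ ni).
Qed.

Lemma ffact_stirling1 (R : comNzRingType) x n : (x ^_ n)%:R =
  \sum_(i < n.+1) (-1) ^+ i * (stirling1 n i)%:R * x%:R ^+ (n - i) :> R.
Proof.
elim: n => [|n IH]; first by rewrite big_ord_recl big_ord0 ffactn0 /= !mulr1 addr0.
(* The factor [x - n] may be read in the ring: when [x < n], where natural subtraction truncates,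
   [x ^_ n] is already zero. *)
have -> : (x ^_ n.+1)%:R = (x ^_ n)%:R * x%:R - n%:R * (x ^_ n)%:R :> R.
  rewrite ffactnSr natrM; case: (leqP n x) => nx; first by rewrite natrB //; ring.
  by rewrite ffact_small // !mul0r mulr0 subrr.
rewrite IH mulr_suml [in LHS]big_ord_recl [in RHS]big_ord_recl !stirling1n0 !subn0.
rewrite -addrA; congr (_ + _); first by rewrite exprSr !mulrA.
rewrite mulr_sumr -sumrN.
rewrite [X in _ + X]big_ord_recr /= [RHS]big_ord_recr /= addrA -big_split /=; congr (_ + _).
  apply: eq_bigr => i _; rewrite /bump /= !add1n subSS.
  have -> : (n - i = (n - i.+1).+1)%N by rewrite subnSK.
  by rewrite natrD natrM !exprS; ring.
rewrite (@stirling1_small n n.+1) // add0n !subnn !expr0 natrM exprS; ring.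
Qed.

(** Each power of [a * b] is a power of [a] times a power of [b], so for fixed [i] the double sum
    factors into two alternating sums of the form in [num_surjE]. *)
Lemma num_incidence_stirling1 (R : comNzRingType) k l n :
  (n`!)%:R * (num_incidence k l n)%:R =
  \sum_(i < n.+1) (-1) ^+ i * (stirling1 n i)%:R *
    (num_surj (n - i) k)%:R * (num_surj (n - i) l)%:R :> R.
Proof.
rewrite num_incidence_binomials mulr_sumr.
transitivity (\sum_(a < k.+1) \sum_(b < l.+1) \sum_(i < n.+1)
  (-1) ^+ i * (stirling1 n i)%:R *
  ((-1) ^+ (k - a) * 'C(k, a)%:R * a%:R ^+ (n - i)) *
  ((-1) ^+ (l - b) * 'C(l, b)%:R * b%:R ^+ (n - i)) : R).
  apply: eq_bigr => a _; rewrite mulr_sumr; apply: eq_bigr => b _.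
  rewrite mulrCA -natrM mulnC bin_ffact ffact_stirling1 mulr_sumr.
  by apply: eq_bigr => i _; rewrite natrM exprMn; ring.
under eq_bigr do rewrite exchange_big.
rewrite exchange_big; apply: eq_bigr => i _.
rewrite !num_surjE -[RHS]mulrA big_distrlr mulr_sumr; apply: eq_bigr => a _.
by rewrite mulr_sumr; apply: eq_bigr => b _; rewrite -!mulrA.
Qed.

(** Induction on [n]; the recursion is absorbed by the first two terms of the binomial expansion of
    [n.+1 ^ (2 * i.+1)]. *)
Lemma stirling1_ub n i : (2 ^ i * i`! * stirling1 n i <= n ^ (2 * i))%N.
Proof.
elim: n i => [|n IH] [|i]; rewrite ?stirling1n0 ?expn0 ?muln0 //.
rewrite stirling1SS mulnDr.
have := IH i.+1; have := IH i; set s := stirling1 n i; set s' := stirling1 n i.+1.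
move=> h1 h2.
have -> : (2 ^ i.+1 * i.+1`! * (n * s) = 2 * i.+1 * n * (2 ^ i * i`! * s))%N.
  by rewrite expnS factS; ring.
apply: (@leq_trans (n ^ (2 * i.+1) + 2 * i.+1 * n * n ^ (2 * i))%N).
  by apply: leq_add => //; rewrite leq_mul2l h1 orbT.
have -> : (2 * i.+1 * n * n ^ (2 * i) = (2 * i.+1) * n ^ (2 * i).+1)%N.
  by rewrite expnS; ring.
have -> : (2 * i.+1 = (2 * i).+2)%N by ring.
rewrite -[n.+1]addn1 expnDn big_ord_recl bin0 mul1n subn0 exp1n muln1 leq_add2l.
by rewrite big_ord_recl /= bin1 exp1n muln1 /bump /= subSS subn0 leq_addr.
Qed.

(** The same induction with falling factorials. The increment of [n ^_ (2 * i.+1)] from [n] to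
    [n.+1] is [(2 * i.+1) * n ^_ (2 * i).+1], and the last factor is at most [n * n ^_ (2 * i)]. *)
Lemma stirling1_lb n i : (n ^_ (2 * i) <= 2 ^ i * i`! * stirling1 n i)%N.
Proof.
elim: n i => [|n IH] [|i]; rewrite ?stirling1n0 //.
rewrite stirling1SS mulnDr.
have := IH i.+1; have := IH i; set s := stirling1 n i; set s' := stirling1 n i.+1.
move=> h1 h2.
have -> : (2 ^ i.+1 * i.+1`! * (n * s) = 2 * i.+1 * n * (2 ^ i * i`! * s))%N.
  by rewrite expnS factS; ring.
apply: (@leq_trans (n ^_ (2 * i.+1) + 2 * i.+1 * n * n ^_ (2 * i))%N); last first.
  by apply: leq_add => //; rewrite leq_mul2l h1 orbT.
have -> : (2 * i.+1 = (2 * i).+2)%N by ring.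
rewrite ffactSS (ffactnSr n (2 * i).+1); set F := (n ^_ (2 * i).+1)%N.
have leF : (F <= n * n ^_ (2 * i))%N.
  by rewrite /F ffactnSr mulnC leq_mul2r leq_subr orbT.
case: (leqP (2 * i).+1 n) => ni; last by rewrite /F ffact_small // muln0.
have -> : (n.+1 * F = F * (n - (2 * i).+1) + (2 * i).+2 * F)%N.
  by rewrite (mulnC F) -mulnDl; congr (_ * _)%N; lia.
by rewrite leq_add2l -mulnA leq_mul2l leF.
Qed.

Local Open Scope classical_set_scope.
Local Open Scope ring_scope.

(** * Fourier coefficients of the exponential function *)

Section CircleIntegral.
Variable R : realType.
Implicit Types (a b t : R) (f g : R -> R).

Notation mu := (@lebesgue_measure R).

(* Real and imaginary parts of [exp (a e^(it)) e^(ibt)]. *)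
Definition expcos a b t : R := expR (a * cos t) * cos (a * sin t + b * t).
Definition expsin a b t : R := expR (a * cos t) * sin (a * sin t + b * t).

(** Differentiating exp (a e^(it) + ibt) in [t] multiplies it by i (a e^(it) + b), and a factor
    e^(it) raises [b] by one. Differentiating in [a] gives the factor e^(it) alone. *)
Lemma is_derive_expcos a b t :
  is_derive t 1 (expcos a b) (- (a * expsin a (b + 1) t + b * expsin a b t)).
Proof.
rewrite /expcos; apply: is_derive_eq.
rewrite /expsin ?scaler0 ?add0r /GRing.scale /= mulrDl mul1r addrA.
by rewrite (sinD (a * sin t + b * t)); ring.
Qed.

Lemma is_derive_expsin a b t :
  is_derive t 1 (expsin a b) (a * expcos a (b + 1) t + b * expcos a b t).
Proof.
rewrite /expsin; apply: is_derive_eq.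
rewrite /expcos ?scaler0 ?add0r /GRing.scale /= mulrDl mul1r addrA.
by rewrite (cosD (a * sin t + b * t)); ring.
Qed.

Lemma is_derive_expcos_param a b t :
  is_derive a 1 (fun x => expcos x b t) (expcos a (b + 1) t).
Proof.
rewrite /expcos; apply: is_derive_eq.
rewrite /GRing.scale /= mulrDl mul1r addrA.
by rewrite (cosD (a * sin t + b * t)); ring.
Qed.

Lemma derive_continuous f (df : R -> R) :
  (forall t, is_derive t 1 f (df t)) -> continuous f.
Proof.
by move=> fd t; apply/differentiable_continuous/derivable1_diffP; case: (fd t).
Qed.

Lemma continuous_expcos a b : continuous (expcos a b).
Proof. exact: derive_continuous (is_derive_expcos a b). Qed.

Lemma continuous_expsin a b : continuous (expsin a b).
Proof. exact: derive_continuous (is_derive_expsin a b). Qed.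

Lemma norm_expcos_le a b t : `|expcos a b t| <= expR `|a|.
Proof.
rewrite normrM ger0_norm ?expR_ge0 // -[leRHS]mulr1.
apply: ler_pM; rewrite ?expR_ge0 ?cos_max // ler_expR.
apply: (le_trans (ler_norm _)); rewrite normrM -[leRHS]mulr1.
by rewrite ler_wpM2l ?cos_max.
Qed.

Definition circ_int f : R := \int[mu]_(t in `[- pi, pi]) f t.

Lemma continuous_circ_integrable f : continuous f ->
  mu.-integrable `[- pi, pi] (EFin \o f).
Proof.
move=> cf; apply: continuous_compact_integrable; first exact: segment_compact.
by apply: continuous_subspaceT.
Qed.

Lemma circ_int_derive f (df : R -> R) : (forall t, is_derive t 1 f (df t)) ->
  continuous df -> circ_int df = f pi - f (- pi).
Proof.
move=> fd cdf; have cf := derive_continuous fd.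
rewrite /circ_int /Rintegral (@continuous_FTC2 _ _ f) //.
- by have := pi_gt0 R; lra.
- exact: continuous_subspaceT.
- split=> [t _||].
  + by case: (fd t).
  + exact/cvg_at_right_filter/cf.
  + exact/cvg_at_left_filter/cf.
- by move=> t _; rewrite derive1E; apply: derive_val.
Qed.

Lemma circ_intD f g : continuous f -> continuous g ->
  circ_int (fun t => f t + g t) = circ_int f + circ_int g.
Proof. by move=> cf cg; apply: RintegralD => //; exact: continuous_circ_integrable. Qed.

Lemma circ_intZ c f : continuous f -> circ_int (fun t => c * f t) = c * circ_int f.
Proof. by move=> cf; apply: RintegralZl => //; exact: continuous_circ_integrable. Qed.

Lemma circ_int_sum (n : nat) (F : 'I_n -> R -> R) : (forall i, continuous (F i)) ->
  circ_int (fun t => \sum_(i < n) F i t) = \sum_(i < n) circ_int (F i).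
Proof.
elim: n F => [|n IH] F cF.
  rewrite big_ord0 /circ_int; under eq_Rintegral do rewrite big_ord0.
  by rewrite /Rintegral integral0.
rewrite big_ord_recr /= -IH // -circ_intD //.
  by apply: eq_Rintegral => t _; rewrite big_ord_recr.
by apply: continuous_big => //; exact: add_continuous.
Qed.

(** The left side is the integral over a full period of the derivative of [expsin a b], whose values
    at both endpoints vanish because [sin (b * pi) = 0]. *)
Lemma circ_int_expcos_rec a b : sin (b * pi) = 0 ->
  a * circ_int (expcos a (b + 1)) + b * circ_int (expcos a b) = 0.
Proof.
move=> sb; have cc x : continuous (expcos a x) by exact: continuous_expcos.
rewrite -!circ_intZ // -circ_intD; last 2 first.
- by move=> t; apply: cvgM; [exact: cvg_cst|exact: cc].
- by move=> t; apply: cvgM; [exact: cvg_cst|exact: cc].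
rewrite (circ_int_derive (is_derive_expsin a b)); last first.
  move=> t; apply: cvgD; apply: cvgM; by [exact: cvg_cst|exact: cc].
rewrite /expsin cosN sinN sinpi oppr0 mulr0 !add0r mulrN sinN sb.
by rewrite oppr0 mulr0 subrr.
Qed.

Lemma circ_int_expcos1 a : circ_int (expcos a 1) = 0.
Proof.
(* The recurrence at [b = 0] only yields [a] times the integral; for [a = 0] the recurrence at
   [b = 1] is used instead. *)
have [->|a0] := eqVneq a 0.
  have := @circ_int_expcos_rec 0 1; rewrite mul1r sinpi => /(_ erefl).
  by rewrite mul0r add0r mul1r.
have := @circ_int_expcos_rec a 0; rewrite mul0r sin0 => /(_ erefl) /eqP.
by rewrite !add0r mul0r addr0 mulf_eq0 (negbTE a0) => /eqP.
Qed.

Lemma is_derive_circ_int_expcos a :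
  is_derive a 1 (fun x => circ_int (expcos x 0)) (circ_int (expcos a 1)).
Proof.
have mI : measurable (`[- pi, pi]%classic : set R) by [].
have aI : `](a - 1), (a + 1)[%classic a by rewrite /= in_itv /=; apply/andP; split; lra.
pose f (x t : R) := expcos x 0 t.
have dE x t : partial1of2 f x t = expcos x 1 t.
  rewrite partial1of2E -[1 in RHS]add0r; apply: derive_val.
  exact: is_derive_expcos_param.
(* A constant dominates the derivative for all parameters within distance 1 of [a]. *)
pose G (_ : R) := expR (`|a| + 1).
have fint (x : R) : `](a - 1), (a + 1)[%classic x ->
    mu.-integrable `[- pi, pi] (EFin \o f x).
  by move=> _; apply: continuous_circ_integrable; exact: continuous_expcos.
have fd (x t : R) : `](a - 1), (a + 1)[%classic x -> `[- pi, pi]%classic t ->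
    derivable (f ^~ t) x 1.
  by move=> _ _; case: (is_derive_expcos_param x 0 t).
have G0 t : 0 <= G t by exact: expR_ge0.
have Gint : mu.-integrable `[- pi, pi] (EFin \o G).
  by apply: continuous_circ_integrable => t; exact: cvg_cst.
have Gub (x t : R) : `](a - 1), (a + 1)[%classic x -> `[- pi, pi]%classic t ->
    `|partial1of2 f x t| <= G t.
  rewrite /= in_itv /= => /andP[x1 x2] _; rewrite dE.
  apply: (le_trans (norm_expcos_le _ _ _)); rewrite ler_expR.
  have: `|x - a| <= 1 by rewrite ler_norml; apply/andP; split; lra.
  have -> : x = a + (x - a) by ring.
  by have := ler_normD a (x - a); rewrite (_ : a + (x - a) - a = x - a); [lra|ring].
have D1 := @derivable_under_integral R _ _ mu f _ mI a _ _ aI fint fd G G0 Gint Gub.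
have D2 := @differentiation_under_integral R _ _ mu f _ mI a _ _ aI fint fd G G0 Gint Gub.
split; first exact: D1.
rewrite -derive1E [LHS]D2.
by apply: eq_Rintegral => t _; rewrite dE.
Qed.

(** The derivative in [a] is the integral of [expcos a 1], which is zero, so the value is the one at
    [a = 0]. *)
Lemma circ_int_expcos0 a : circ_int (expcos a 0) = 2 * pi.
Proof.
transitivity (circ_int (expcos 0 0)).
  apply: (is_derive_0_is_cst (f := fun x => circ_int (expcos x 0))) => x.
  by have := is_derive_circ_int_expcos x; rewrite circ_int_expcos1.
rewrite (_ : expcos 0 0 = cst 1); last first.
  by apply/funext => t; rewrite /expcos !mul0r addr0 cos0 expR0 mulr1.
have idd (t : R) : is_derive t 1 id (cst 1 t : R) by exact: is_derive_id.
rewrite (circ_int_derive idd); first by rewrite opprK -mulr2n mulr_natl.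
by move=> t; exact: cvg_cst.
Qed.

Lemma sin_natpi (m : nat) : sin (- m%:R * pi) = 0 :> R.
Proof.
rewrite mulNr sinN mulr_natl; apply/eqP; rewrite oppr_eq0; apply/eqP.
elim: m => [|m IH]; first by rewrite mulr0n sin0.
by rewrite mulrS addrC sinDpi IH oppr0.
Qed.

(** These are the Fourier coefficients of exp (a e^(it)); the recurrence at [b = - m.+1%:R] passes
    from [m] to [m.+1]. *)
Lemma circ_int_expcosN a (m : nat) :
  circ_int (expcos a (- m%:R)) = 2 * pi * a ^+ m / m`!%:R.
Proof.
elim: m => [|m IH]; first by rewrite oppr0 circ_int_expcos0 expr0 fact0 divr1 mulr1.
have := circ_int_expcos_rec a (sin_natpi m.+1).
rewrite (_ : - m.+1%:R + 1 = - m%:R); last by rewrite -natr1; ring.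
have m0 : m.+1%:R != 0 :> R by rewrite pnatr_eq0.
have mf0 : m`!%:R != 0 :> R by rewrite pnatr_eq0 -lt0n fact_gt0.
move=> h; apply: (mulfI m0); have -> : m.+1%:R * circ_int (expcos a (- m.+1%:R)) =
  a * circ_int (expcos a (- m%:R)).
  by apply/eqP; rewrite -subr_eq0 -oppr_eq0 -h; apply/eqP; ring.
by rewrite IH exprS factS natrM; field; rewrite mf0 nat1r m0.
Qed.

End CircleIntegral.

(** * Laplace's method for powers of a complex function *)

Section Complex.
Variable R : realType.
Implicit Types (a b t : R) (z w : R[i]).
Import ComplexField.Normc.

Lemma Re_le_normc z : `|Re z| <= normc z.
Proof.
case: z => x y /=; rewrite -sqrtr_sqr ler_wsqrtr // lerDl; exact: sqr_ge0.
Qed.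

Lemma normc_ge0 z : 0 <= normc z.
Proof. by case: z => x y /=; exact: sqrtr_ge0. Qed.

Lemma normc_le_ReIm z : normc z <= `|Re z| + `|Im z|.
Proof.
case: z => x y /=; rewrite -[leRHS]ger0_norm ?addr_ge0 // -sqrtr_sqr ler_wsqrtr //.
rewrite sqrrD !real_normK ?num_real // -addrA lerD2l addrC lerDl.
by rewrite mulrn_wge0 ?mulr_ge0.
Qed.

Lemma normc_real a : normc a%:C%C = `|a|.
Proof. by rewrite /= expr0n addr0 sqrtr_sqr. Qed.

Lemma normcX z n : normc (z ^+ n) = normc z ^+ n.
Proof.
by elim: n => [|n IH]; rewrite ?expr0 ?exprS ?normcM ?IH // normc1.
Qed.

(** Telescoping inside the unit disc. It lets a power of one function be replaced by that of another
    at a cost linear in the exponent. *)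
Lemma normc_exprB z w n : normc z <= 1 -> normc w <= 1 ->
  normc (z ^+ n - w ^+ n) <= n%:R * normc (z - w).
Proof.
move=> z1 w1; elim: n => [|n IH]; first by rewrite !expr0 subrr normc0 mul0r.
have -> : z ^+ n.+1 - w ^+ n.+1 = z * (z ^+ n - w ^+ n) + (z - w) * w ^+ n.
  by rewrite !exprS; ring.
apply: (le_trans (le_normcD _ _)); rewrite !normcM -nat1r mulrDl mul1r addrC.
apply: lerD.
  by rewrite -[leRHS]mulr1 ler_wpM2l ?normc_ge0 // normcX exprn_ile1 ?normc_ge0.
by apply: (le_trans _ IH); rewrite ler_piMl ?normc_ge0.
Qed.

Definition cexp a b t : R[i] := (expcos a b t +i* expsin a b t)%C.

Lemma cexpM a b a' b' t : cexp a b t * cexp a' b' t = cexp (a + a') (b + b') t.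
Proof.
rewrite /cexp /expcos /expsin !mulrDl expRD.
rewrite (_ : a * sin t + a' * sin t + _ =
  (a * sin t + b * t) + (a' * sin t + b' * t)); last by ring.
rewrite (cosD (a * sin t + b * t)) (sinD (a * sin t + b * t)).
by apply/eqP; rewrite eq_complex /=; apply/andP; split; apply/eqP; ring.
Qed.

Lemma cexp00 t : cexp 0 0 t = 1.
Proof.
by rewrite /cexp /expcos /expsin !mul0r addr0 expR0 cos0 sin0 mulr1 mulr0.
Qed.

Lemma cexpX a b t n : cexp a b t ^+ n = cexp (n%:R * a) (n%:R * b) t.
Proof.
elim: n => [|n IH]; first by rewrite expr0 !mul0r cexp00.
by rewrite exprS IH cexpM -!nat1r !mulrDl !mul1r.
Qed.

Lemma normc_cexp a b t : normc (cexp a b t) = expR (a * cos t).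
Proof.
rewrite /= /expcos /expsin !exprMn -mulrDr cos2Dsin2 mulr1 sqrtr_sqr.
by rewrite ger0_norm ?expR_ge0.
Qed.

(** Continuity is asked of the two real components, as only real functions are integrated. *)
Definition ccontinuous (F : R -> R[i]) :=
  continuous (fun t => Re (F t)) /\ continuous (fun t => Im (F t)).

Lemma ccontinuous_cexp a b : ccontinuous (cexp a b).
Proof. by split; [exact: continuous_expcos|exact: continuous_expsin]. Qed.

Lemma ccontinuous_cst z : ccontinuous (fun=> z).
Proof. by split=> t; exact: cvg_cst. Qed.

Lemma ccontinuousD F G : ccontinuous F -> ccontinuous G ->
  ccontinuous (fun t => F t + G t).
Proof.
move=> [F1 F2] [G1 G2]; split.
  rewrite (_ : (fun t => _) = (fun t => Re (F t) + Re (G t))).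
    by move=> t; apply: cvgD; [exact: F1|exact: G1].
  by apply/funext => t; case: (F t) (G t) => [? ?] [].
rewrite (_ : (fun t => _) = (fun t => Im (F t) + Im (G t))).
  by move=> t; apply: cvgD; [exact: F2|exact: G2].
by apply/funext => t; case: (F t) (G t) => [? ?] [].
Qed.

Lemma ccontinuousM F G : ccontinuous F -> ccontinuous G ->
  ccontinuous (fun t => F t * G t).
Proof.
move=> [F1 F2] [G1 G2]; split.
  rewrite (_ : (fun t => _) = (fun t => Re (F t) * Re (G t) - Im (F t) * Im (G t))).
    by move=> t; apply: cvgB; apply: cvgM; [exact: F1|exact: G1|exact: F2|exact: G2].
  by apply/funext => t; case: (F t) (G t) => [? ?] [].
rewrite (_ : (fun t => _) = (fun t => Re (F t) * Im (G t) + Im (F t) * Re (G t))).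
  by move=> t; apply: cvgD; apply: cvgM; [exact: F1|exact: G2|exact: F2|exact: G1].
by apply/funext => t; case: (F t) (G t) => [? ?] [].
Qed.

Lemma ccontinuousX F n : ccontinuous F -> ccontinuous (fun t => F t ^+ n).
Proof.
move=> cF; elim: n => [|n IH]; first exact: ccontinuous_cst.
by under eq_fun do rewrite exprS; exact: ccontinuousM.
Qed.

End Complex.

(** * Dilation of the circle and the Gaussian integral *)

Section Gaussian.
Variable R : realType.
Import ComplexField.Normc.
Notation mu := (@lebesgue_measure R).

Lemma circ_int_dilate (h : R -> R) (q : R) : 0 < q -> continuous h ->
  q * circ_int h = \int[mu]_(u in `[- (pi * q), pi * q]) h (u / q).
Proof.
move=> q0 ch; pose F := (fun u : R => u / q).
have dF (u : R) : is_derive u 1 F q^-1.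
  by rewrite /F; apply: is_derive_eq; rewrite scaler0 add0r /GRing.scale /= mulr1.
have F'E : F^`()%classic = cst q^-1.
  by apply/funext => u; rewrite derive1E; apply: derive_val.
have cF := derive_continuous dF.
have qN0 : q != 0 by rewrite gt_eqF.
pose L := pi * q; have E : (\int[mu]_(x in `[F (- L)%R, F L]) (h x)%:E =
  \int[mu]_(x in `[(- L)%R, L]) (((h \o F) * F^`()%classic)%R x)%:E)%E.
  apply: integration_by_substitution_increasing.
  - have L0 : 0 <= L by rewrite /L mulr_ge0 ?pi_ge0 ?ltW.
    by lra.
  - by move=> x y _ _ xy; rewrite /F ltr_pM2r ?invr_gt0.
  - by rewrite F'E => x _; exact: cvg_cst.
  - by rewrite F'E; exact: is_cvg_cst.
  - by rewrite F'E; exact: is_cvg_cst.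
  - split=> [t _||].
    + by case: (dF t).
    + exact/cvg_at_right_filter/cF.
    + exact/cvg_at_left_filter/cF.
  - exact: continuous_subspaceT.
rewrite /circ_int; have -> : \int[mu]_(t in `[- pi, pi]) h t =
   \int[mu]_(x in `[- (pi * q), pi * q]) (q^-1 * h (x / q)).
  rewrite /Rintegral; move: E; rewrite /F /L mulNr mulfK // => ->.
  by congr fine; apply: eq_integral => x _; rewrite F'E /= [in RHS]mulrC.
rewrite RintegralZl ?mulrA ?divff ?mul1r //.
apply: continuous_compact_integrable; first exact: segment_compact.
apply: continuous_subspaceT => x; apply: continuous_comp; last exact: ch.
exact: cF.
Qed.

(** The function is a multiple of the centred normal density of variance 1 / (2s). *)
Lemma lebesgue_gauss (s : R) : 0 < s ->
  mu.-integrable setT (EFin \o (fun u => expR (- (s * u ^+ 2)))) /\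
  \int[mu]_u expR (- (s * u ^+ 2)) = Num.sqrt (pi / s).
Proof.
move=> s0; pose sg := (Num.sqrt (2 * s))^-1.
have sg0 : 0 < sg by rewrite invr_gt0 sqrtr_gt0 mulr_gt0.
have sgN : sg != 0 by rewrite gt_eqF.
have sg2 : sg ^+ 2 = (2 * s)^-1 by rewrite exprVn sqr_sqrtr // mulr_ge0 ?ltW.
have pE u : expR (- (s * u ^+ 2)) = (normal_peak sg)^-1 * normal_pdf 0 sg u.
  rewrite normal_pdfE // mulrA mulVf ?mul1r ?gt_eqF ?normal_peak_gt0 //.
  rewrite /normal_fun subr0 sg2; congr expR; field; lra.
have ip : mu.-integrable setT (EFin \o normal_pdf 0 sg) by exact: integrable_normal_pdf.
split.
  under eq_fun do rewrite pE.
  by apply: (integrableZl _ _ ip) => //.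
under eq_Rintegral do rewrite pE.
rewrite RintegralZl // /Rintegral integral_normal_pdf /= mulr1 /normal_peak invrK.
by rewrite sg2; congr Num.sqrt; field; lra.
Qed.

End Gaussian.

(** * Integrals of high powers by dominated convergence *)

Section LaplaceMethod.
Variable R : realType.
Import ComplexField.Normc.
Notation mu := (@lebesgue_measure R).

Lemma cvg_div_sqrt_nat (u : R) : u / Num.sqrt k.+1%:R @[k --> \oo] --> (0 : R).
Proof.
rewrite -[X in _ --> X](mulr0 u); apply: cvgM; first exact: cvg_cst.
have -> : (fun k => (Num.sqrt k.+1%:R)^-1) = (fun k => Num.sqrt (k.+1%:R^-1)) :> (nat -> R).
  by apply/funext => k; rewrite sqrtrV.
rewrite -[X in _ --> X](@sqrtr0 R).
apply: continuous_cvg; first exact: sqrt_continuous.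
exact: cvg_harmonic.
Qed.

Section PowerIntegral.
Variables (Phi : R -> R[i]) (s c j : R).
Hypothesis cPhi : ccontinuous Phi.
Hypothesis s_gt0 : 0 < s.
Hypothesis c_gt0 : 0 < c.
Hypothesis Phi0 : Phi 0 = 1.
Hypothesis Phi_le : forall t, `|t| <= pi -> normc (Phi t) <= expR (- (c * t ^+ 2)).
Hypothesis RePhi :
  (Re (Phi x) - expR (- (s * x ^+ 2))) / x ^+ 2 @[x --> 0] --> (0 : R).
Hypothesis ImPhi : Im (Phi x) / x ^+ 2 @[x --> 0] --> (0 : R).

Let h k t := Re (Phi t ^+ k.+1 * cexp 0 j t).

Let ch k : continuous (h k).
Proof.
suff [] : ccontinuous (fun t => Phi t ^+ k.+1 * cexp 0 j t) by [].
by apply: ccontinuousM; [exact: ccontinuousX|exact: ccontinuous_cexp].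
Qed.

(** [eta] measures the distance from [Phi] to the Gaussian in units of [x ^+ 2], and [theta] that
    from e^(ijx) to 1. Both tend to 0 at the origin. *)
Let eta x : R := `|(Re (Phi x) - expR (- (s * x ^+ 2))) / x ^+ 2| + `|Im (Phi x) / x ^+ 2|.
Let theta x : R := `|expcos 0 j x - 1| + `|expsin 0 j x|.

Let h_ub k t : `|t| <= pi -> `|h k t| <= expR (- (c * t ^+ 2) * k.+1%:R).
Proof.
move=> tpi; apply: (le_trans (Re_le_normc _)).
rewrite normcM normc_cexp mul0r expR0 mulr1 normcX expRM_natr.
by rewrite lerXn2r ?nnegrE ?normc_ge0 ?expR_ge0 // Phi_le.
Qed.

Let h_cvg k t : `|t| <= pi ->
  `|h k t - expR (- (s * t ^+ 2) * k.+1%:R)| <= t ^+ 2 * k.+1%:R * eta t + theta t.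
Proof.
move=> tpi; set w := expR (- (s * t ^+ 2)).
have w0 : 0 <= w by exact: expR_ge0.
have w1 : w <= 1.
  by rewrite /w -[leRHS]expR0 ler_expR oppr_le0 mulr_ge0 ?sqr_ge0 // ltW.
have nw : normc w%:C%C <= 1 by rewrite normc_real ger0_norm.
have nPhi : normc (Phi t) <= 1.
  apply: (le_trans (Phi_le tpi)).
  by rewrite -[leRHS]expR0 ler_expR oppr_le0 mulr_ge0 ?sqr_ge0 // ltW.
have -> : h k t - expR (- (s * t ^+ 2) * k.+1%:R) =
    Re (Phi t ^+ k.+1 * cexp 0 j t - (w%:C%C) ^+ k.+1).
  rewrite expRM_natr -/w -rmorphXn /= /h.
  by case: (Phi t ^+ k.+1 * _) => x y.
apply: (le_trans (Re_le_normc _)).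
have -> : Phi t ^+ k.+1 * cexp 0 j t - (w%:C%C) ^+ k.+1 =
   (Phi t ^+ k.+1 - (w%:C%C) ^+ k.+1) * cexp 0 j t + (w%:C%C) ^+ k.+1 * (cexp 0 j t - 1).
  by ring.
apply: (le_trans (le_normcD _ _)); apply: lerD; rewrite normcM.
  rewrite normc_cexp mul0r expR0 mulr1.
  apply: (le_trans (normc_exprB k.+1 nPhi nw)).
  rewrite [leRHS]mulrAC [leRHS]mulrC ler_wpM2l //.
  (* The quotients in [eta] can be cleared only for [t] nonzero; at 0 the two bases are both 1. *)
  have [t0|t0] := eqVneq t 0.
    by rewrite /w t0 Phi0 expr2 !mul0r mulr0 oppr0 expR0 rmorph1 subrr normc0.
  apply: (le_trans (normc_le_ReIm _)).
  have t2 : 0 < t ^+ 2 by rewrite exprn_even_gt0.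
  rewrite /eta mulrDr !normrM (gtr0_norm (x := (t ^+ 2)^-1)) ?invr_gt0 //.
  rewrite ![t ^+ 2 * (_ * _)]mulrCA !divff ?gt_eqF // !mulr1.
  by case: (Phi t) => x y /=; rewrite oppr0 addr0.
rewrite -[leRHS]mul1r ler_pM ?normc_ge0 //.
  by rewrite normcX exprn_ile1 ?normc_ge0.
by apply: (le_trans (normc_le_ReIm _)); rewrite /theta /= subr0.
Qed.

(** With t = u / sqrt (k + 1), the integrand tends to exp (- s u^2), because [Phi] agrees with the
    Gaussian up to o(t^2), an error that the power multiplies only by k + 1. The global bound with
    rate [c] gives the dominating function exp (- c u^2). *)
Lemma laplace_method :
  Num.sqrt k.+1%:R * circ_int (fun t => Re (Phi t ^+ k.+1 * cexp 0 j t)) @[k --> \oo]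
  --> Num.sqrt (pi / s).
Proof.
have q0 k : 0 < Num.sqrt k.+1%:R :> R by rewrite sqrtr_gt0.
have q2 k (u : R) : (u / Num.sqrt k.+1%:R) ^+ 2 * k.+1%:R = u ^+ 2.
  by rewrite exprMn exprVn sqr_sqrtr // mulfVK.
(* The dilated period grows with [k]; extension by zero outside it places all integrands on the real
   line, and each fixed [u] is eventually inside. *)
pose D k := `[- (pi * Num.sqrt k.+1%:R), pi * Num.sqrt k.+1%:R]%classic : set R.
pose f_ k : R -> R := (fun u => h k (u / Num.sqrt k.+1%:R)) \_ (D k).
have inD k u : D k u -> `|u / Num.sqrt k.+1%:R| <= pi.
  rewrite /D /= in_itv /= => uD.
  by rewrite normrM normfV (gtr0_norm (q0 k)) ler_pdivrMr // ler_norml.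
have mf k : measurable_fun (setT : set (measurableTypeR R)) (EFin \o f_ k).
  apply/measurable_EFinP; apply/(measurable_restrictT _ _).1; first exact: measurable_itv.
  apply: measurable_funTS.
  apply: continuous_measurable_fun => x; apply: continuous_comp; last exact: ch.
  by apply: cvgM; [exact: cvg_id|exact: cvg_cst].
have [ig _] := lebesgue_gauss c_gt0.
have [igs sE] := lebesgue_gauss s_gt0.
have mg : measurable_fun (setT : set (measurableTypeR R))
    (EFin \o (fun u : R => expR (- (s * u ^+ 2)))).
  by case/integrableP: igs.
have fcvg (u : R) : (fun k => (f_ k u)%:E) @ \oo -->
    (EFin \o (fun u => expR (- (s * u ^+ 2)))) u.
  apply: cvg_EFin; first by apply: nearW.
  have xk := cvg_div_sqrt_nat u.
  have eta0 : eta x @[x --> 0] --> (0 : R).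
    rewrite -[X in _ --> X]addr0; apply: cvgD.
      by rewrite -[X in _ --> X](@normr0 R R); exact: cvg_norm RePhi.
    by rewrite -[X in _ --> X](@normr0 R R); exact: cvg_norm ImPhi.
  have theta0 : theta x @[x --> 0] --> (0 : R).
    have th0 : theta 0 = 0.
      rewrite /theta /expcos /expsin !(mul0r, mulr0) addr0 cos0 sin0 expR0.
      by rewrite mulr1 subrr mulr0 normr0 addr0.
    rewrite -[X in _ --> X]th0; apply: cvgD; apply: cvg_norm; last exact: continuous_expsin.
    by apply: cvgB; [exact: continuous_expcos|exact: cvg_cst].
  have B0 : u ^+ 2 * eta (u / Num.sqrt k.+1%:R) + theta (u / Num.sqrt k.+1%:R)
      @[k --> \oo] --> (0 : R).
    rewrite -[X in _ --> X]addr0; apply: cvgD; last exact: cvg_comp xk theta0.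
    rewrite -[X in _ --> X](mulr0 (u ^+ 2)); apply: cvgM; first exact: cvg_cst.
    exact: cvg_comp xk eta0.
  apply/cvgrPdist_le => e e0; near=> k.
  have uD : D k u.
    rewrite /D /= in_itv /= -ler_norml -ler_pdivrMr //.
    rewrite -[X in _ / X](gtr0_norm (q0 k)) -normfV -normrM ltW //.
    near: k; apply: cvgr0_norm_lt xk _ (pi_gt0 R).
  rewrite /f_ /= patchE mem_set // distrC.
  have := h_cvg k (inD _ _ uD); rewrite mulNr -(mulrA s) !q2 => /le_trans; apply.
  apply: (le_trans (ler_norm _)); near: k; exact: cvgr0_norm_le B0 _ e0.
have fle (u : R) k : (`|(f_ k u)%:E| <= (EFin \o (fun u => expR (- (c * u ^+ 2)))) u)%E.
  rewrite /f_ /= lee_fin patchE; case: ifPn => [/set_mem uD|_]; last by rewrite normr0 expR_ge0.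
  by apply: (le_trans (h_ub k (inD _ _ uD))); rewrite mulNr -mulrA q2.
have [] := @dominated_convergence _ (measurableTypeR R) R mu setT measurableT
  (fun k => EFin \o f_ k) (EFin \o (fun u : R => expR (- (s * u ^+ 2))))
  (EFin \o (fun u : R => expR (- (c * u ^+ 2)))) mf mg _ ig _.
- by apply: aeW => u _; exact: fcvg.
- by apply: aeW => u k _; exact: fle.
move=> _ _.
move: sE; rewrite /Rintegral => <-; move=> dcv.
have : (fun k => fine (\int[mu]_x (f_ k x)%:E)%E) @ \oo -->
    fine (\int[mu]_x (expR (- (s * x ^+ 2)))%:E)%E.
  apply: fine_cvg; rewrite fineK; first exact: dcv.
  exact: integrable_fin_num igs.
apply: cvg_trans; apply: near_eq_cvg; apply: nearW => k.
rewrite circ_int_dilate //; last exact: ch.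
by rewrite Rintegral_mkcond.
Unshelve. all: by end_near. Qed.
End PowerIntegral.
End LaplaceMethod.

(** * Second-order behaviour at the saddle point *)

Section SaddlePoint.
Variable R : realType.
Import ComplexField.Normc.

(** L'Hospital's rule is applied twice. *)
Lemma cvg_div_sqr0 (f f1 f2 : R -> R) :
  (forall x : R, is_derive x 1 f (f1 x)) -> (forall x : R, is_derive x 1 f1 (f2 x)) ->
  continuous f2 -> f 0 = 0 -> f1 0 = 0 -> f2 0 = 0 ->
  f x / x ^+ 2 @[x --> 0] --> (0 : R).
Proof.
move=> df df1 cf2 f00 f10 f20.
have cf := derive_continuous df; have cf1 := derive_continuous df1.
have I01 : (0 : R) \in `](-1), 1[ by rewrite in_itv /=; apply/andP; split; lra.
have d2x (x : R) : is_derive x 1 (fun y : R => 2 * y) 2.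
  by apply: is_derive_eq; rewrite /GRing.scale /= mulr1.
have dx2 (x : R) : is_derive x 1 (fun y : R => y ^+ 2) (2 * x).
  by apply: is_derive_eq; rewrite /GRing.scale /=; ring.
(* The limits are over full neighbourhoods of 0. Division by zero gives 0, which is also the limit,
   so the punctured limit suffices. *)
have fill (g : R -> R) : g 0 = 0 -> g x @[x --> 0^'] --> (0 : R) ->
    g x @[x --> 0] --> (0 : R).
  by move=> g0; rewrite -{2 4}g0 => h; apply/continuous_withinNx.
have c1 : f1 x / (2 * x) @[x --> 0] --> (0 : R).
  apply: (fill (fun x => f1 x / (2 * x))); first by rewrite f10 mul0r.
  apply: (@lhopital R f1 f2 (fun x => 2 * x) (fun=> 2) (-1) 1 0 0) => //.
  - by rewrite -[X in _ --> X]f10; exact: cf1.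
  - rewrite -[X in _ --> X](mulr0 2); apply: cvgM; first exact: cvg_cst.
    exact: cvg_id.
  - rewrite -[X in _ --> X](mul0r 2^-1); apply: cvgM; last exact: cvg_cst.
    by rewrite -[X in _ --> X]f20; exact: cf2.
apply: (fill (fun x => f x / x ^+ 2)); first by rewrite f00 mul0r.
apply: (@lhopital R f f1 (fun x => x ^+ 2) (fun x => 2 * x) (-1) 1 0 0) => //.
- by rewrite -[X in _ --> X]f00; exact: cf.
- rewrite -[X in _ --> X](@expr0n R 2); exact: exprn_continuous.
- move=> x /set_mem [_ /= /eqP x0]; rewrite mulf_neq0 //.
Qed.

#[local] Existing Instance is_derive_expcos.
#[local] Existing Instance is_derive_expsin.
#[local] Typeclasses Opaque expcos expsin.

(** The hypotheses match the value and the second derivative at 0 with those of the Gaussian; the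
    first derivatives vanish there since all functions are even. *)
Lemma cvg_gauss_osculation (al be a b s : R) :
  al * expR a + be = 1 ->
  al * expR a * (a ^+ 2 + (2 * b + 1) * a + b ^+ 2) + be * b ^+ 2 = 2 * s ->
  (al * expcos a b x + be * expcos 0 b x - expR (- (s * x ^+ 2))) / x ^+ 2
    @[x --> 0] --> (0 : R).
Proof.
move=> h0 h2.
pose f1 x : R := al * - (a * expsin a (b + 1) x + b * expsin a b x)
  + be * - (b * expsin 0 b x) + 2 * s * x * expR (- (s * x ^+ 2)).
pose f2 x : R := al * - (a * (a * expcos a (b + 1 + 1) x + (b + 1) * expcos a (b + 1) x)
    + b * (a * expcos a (b + 1) x + b * expcos a b x))
  + be * - (b * (b * expcos 0 b x)) +
  (2 * s - 4 * s ^+ 2 * x ^+ 2) * expR (- (s * x ^+ 2)).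
have c0 u v : expcos u v 0 = expR u :> R.
  by rewrite /expcos cos0 sin0 !mulr0 addr0 cos0 !mulr1.
have s0 u v : expsin u v 0 = 0 :> R.
  by rewrite /expsin sin0 !mulr0 addr0 sin0 mulr0.
apply: (@cvg_div_sqr0 _ f1 f2).
- by move=> x; apply: is_derive_eq; rewrite /f1 /GRing.scale /=; ring.
- by move=> x; rewrite /f1; apply: is_derive_eq; rewrite /f2 /GRing.scale /=; ring.
- have f2d (x : R) : derivable f2 x 1 by rewrite /f2; apply: ex_derive.
  by move=> x; exact/differentiable_continuous/derivable1_diffP.
- by rewrite !c0 !expr2 !mulr0 oppr0 expR0 mulr1; lra.
- by rewrite /f1 !s0 !mulr0 !mul0r; lra.
- by rewrite /f2 !c0 !expr2 !mulr0 oppr0 expR0 mulr1; lra.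
Qed.

(** The function is odd, so only its first derivative at 0 has to be cancelled by hypothesis. *)
Lemma cvg_expsin_osculation (al be a b : R) :
  al * expR a * (a + b) + be * b = 0 ->
  (al * expsin a b x + be * expsin 0 b x) / x ^+ 2 @[x --> 0] --> (0 : R).
Proof.
move=> h1.
pose f1 x : R := al * (a * expcos a (b + 1) x + b * expcos a b x)
  + be * (b * expcos 0 b x).
pose f2 x : R := al * - (a * (a * expsin a (b + 1 + 1) x + (b + 1) * expsin a (b + 1) x)
    + b * (a * expsin a (b + 1) x + b * expsin a b x))
  + be * - (b * (b * expsin 0 b x)).
have c0 u v : expcos u v 0 = expR u :> R.
  by rewrite /expcos cos0 sin0 !mulr0 addr0 cos0 !mulr1.
have s0 u v : expsin u v 0 = 0 :> R.
  by rewrite /expsin sin0 !mulr0 addr0 sin0 mulr0.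
apply: (@cvg_div_sqr0 _ f1 f2).
- by move=> x; apply: is_derive_eq; rewrite /f1 /GRing.scale /=; ring.
- by move=> x; rewrite /f1; apply: is_derive_eq; rewrite /f2 /GRing.scale /=; ring.
- have f2d (x : R) : derivable f2 x 1 by rewrite /f2; apply: ex_derive.
  by move=> x; exact/differentiable_continuous/derivable1_diffP.
- by rewrite !s0; lra.
- by rewrite /f1 !c0 expR0; lra.
- by rewrite /f2 !s0; lra.
Qed.

(** The base of the power is shaped like the characteristic function of a shifted Poisson law
    ([be = 0]) or of one conditioned to be positive ([be = - al]). The three equations state total
    mass 1, mean 0 and variance [2 * s]. *)
Lemma laplace_cexp (al be a b s c j : R) : 0 < s -> 0 < c ->
  al * expR a + be = 1 -> al * expR a * (a + b) + be * b = 0 ->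
  al * expR a * (a ^+ 2 + (2 * b + 1) * a + b ^+ 2) + be * b ^+ 2 = 2 * s ->
  (forall t, `|t| <= pi ->
    normc (al%:C%C * cexp a b t + be%:C%C * cexp 0 b t) <= expR (- (c * t ^+ 2))) ->
  Num.sqrt k.+1%:R * circ_int (fun t =>
    Re ((al%:C%C * cexp a b t + be%:C%C * cexp 0 b t) ^+ k.+1 * cexp 0 j t))
  @[k --> \oo] --> Num.sqrt (pi / s).
Proof.
move=> s0 c0 h0 h1 h2 Pub.
have ReE t : Re (al%:C%C * cexp a b t + be%:C%C * cexp 0 b t) =
  al * expcos a b t + be * expcos 0 b t by rewrite /=; ring.
have ImE t : Im (al%:C%C * cexp a b t + be%:C%C * cexp 0 b t) =
  al * expsin a b t + be * expsin 0 b t by rewrite /=; ring.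
apply: (@laplace_method _ (fun t => al%:C%C * cexp a b t + be%:C%C * cexp 0 b t) s c).
- by apply: ccontinuousD; apply: ccontinuousM; (exact: ccontinuous_cst || exact: ccontinuous_cexp).
- exact: s0.
- exact: c0.
- apply/eqP; rewrite eq_complex ReE ImE /expcos /expsin sin0 cos0 !mulr0 !addr0 sin0 cos0.
  by rewrite !mulr0 !mulr1 expR0 mulr1 addr0 h0 !eqxx.
- exact: Pub.
- by under eq_fun do rewrite ReE; exact: cvg_gauss_osculation.
- by under eq_fun do rewrite ImE; exact: cvg_expsin_osculation.
Qed.

End SaddlePoint.

(** * Surjections and the truncated Poisson law *)

Section Surjections.
Variable R : realType.
Import ComplexField.Normc.

Lemma MVT_continuous (f df : R -> R) (a b : R) : a <= b ->
  (forall x : R, is_derive x 1 f (df x)) ->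
  exists2 c, a <= c <= b & f b - f a = df c * (b - a).
Proof.
move=> ab fd; have cf := derive_continuous fd.
have [c + E] := @MVT_segment _ f df a b ab (fun x _ => fd x) (continuous_subspaceT cf).
by rewrite in_itv /=; exists c.
Qed.

Lemma sqr_sin_le (y : R) : sin y ^+ 2 <= y ^+ 2.
Proof.
wlog y0 : y / 0 <= y => [hw|].
  have [/hw //|y0] := leP 0 y.
  by have := hw (- y); rewrite sinN !sqrrN; apply; lra.
have [c _] := @MVT_continuous sin cos 0 y y0 (fun x => is_derive_sin x).
by rewrite sin0 !subr0 => ->; rewrite exprMn ler_piMl ?sqr_ge0 //.
Qed.

(** Here 1 - cos 4v = 2 sin^2 (2v), and sin 2v >= v: the mean value theorem gives sin v >= v cos v,
    while 2 cos^2 v >= 1 because cos 2v >= 0. *)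
Lemma one_sub_cos4_ge (v : R) : 0 <= v -> v <= pi / 4 ->
  2 * v ^+ 2 <= 1 - cos ((v *+ 2) *+ 2).
Proof.
move=> v0 v1; have pi0 := pi_gt0 R.
have [c cv] := @MVT_continuous sin cos 0 v v0 (fun x => is_derive_sin x).
rewrite sin0 !subr0 => sv.
have cc : cos v <= cos c.
  case/andP: cv => c0; rewrite le_eqVlt => /predU1P[->//|cv].
  have cI : c \in `[0, pi] by rewrite in_itv /=; lra.
  have vI : v \in `[0, pi] by rewrite in_itv /=; lra.
  by apply: ltW; rewrite (ltr_cos cI vI).
have c2 : 0 <= cos (v *+ 2) by apply: cos_ge0_pihalf; rewrite (mulr2n v); lra.
have cv0 : 0 <= cos v by apply: cos_ge0_pihalf; lra.
move: c2; rewrite cos_mulr2n => c2.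
have h : v <= (cos v * sin v) *+ 2.
  rewrite sv (mulr2n (_ * _)).
  have h1 : cos v * v <= cos c * v by rewrite ler_wpM2r.
  have : cos v * (cos v * v) <= cos v * (cos c * v) by rewrite ler_wpM2l.
  have : 0 <= (cos v ^+ 2 *+ 2 - 1) * v by rewrite mulr_ge0.
  by rewrite (mulr2n (_ ^+ 2)) expr2; lra.
rewrite cos_mulr2n cos2sin2 sin_mulr2n.
have : v ^+ 2 <= ((cos v * sin v) *+ 2) ^+ 2.
  by rewrite lerXn2r // nnegrE // (le_trans v0).
by rewrite !(mulr2n (1 - _)); lra.
Qed.

Lemma one_sub_cos_ge (t : R) : `|t| <= pi -> t ^+ 2 / 8 <= 1 - cos t.
Proof.
move=> tpi; have := @one_sub_cos4_ge (`|t| / 4).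
have -> : (`|t| / 4) *+ 2 *+ 2 = `|t| by rewrite -mulrnA -(mulr_natr (_ / _)) divfK // pnatr_eq0.
rewrite cos_norm exprMn real_normK ?num_real //.
have := normr_ge0 t => t0 h.
by apply: (le_trans _ (h _ _)); lra.
Qed.

Lemma expRB_expRN_ge (y : R) : 0 <= y -> 2 * y <= expR y - expR (- y).
Proof.
move=> y0; pose h (x : R) := expR x - expR (- x) - 2 * x.
have dh (x : R) : is_derive x 1 h (expR x + expR (- x) - 2).
  by rewrite /h; apply: is_derive_eq; rewrite /GRing.scale /=; ring.
have [c _] := MVT_continuous y0 dh.
rewrite /h oppr0 mulr0 !(subr0, addr0) => E.
have : 0 <= (expR c + expR (- c) - 2) * y.
  by apply: mulr_ge0 => //; have := expR_ge1Dx c; have := expR_ge1Dx (- c); lra.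
by rewrite -E; lra.
Qed.

(** Up to a factor 4 the function is sinh^2 x - x^2. It is even, and for x >= 0 its derivative sinh
    2x - 2x is nonnegative. *)
Lemma sqr_expRB_expRN_le (x r : R) : `|x| <= r ->
  (expR x - expR (- x)) ^+ 2 - 4 * x ^+ 2 <= (expR r - expR (- r)) ^+ 2 - 4 * r ^+ 2.
Proof.
have -> : (expR x - expR (- x)) ^+ 2 - 4 * x ^+ 2 =
    (expR `|x| - expR (- `|x|)) ^+ 2 - 4 * `|x| ^+ 2.
  have [x0|x0] := ger0P x; first by [].
  by rewrite opprK; ring.
have := normr_ge0 x; move: `|x| => {}x x0 xr.
pose g (x : R) := (expR x - expR (- x)) ^+ 2 - 4 * x ^+ 2.
pose dg (x : R) := 2 * (expR x - expR (- x)) * (expR x + expR (- x)) - 8 * x.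
have dgE (y : R) : is_derive y 1 g (dg y).
  by rewrite /g; apply: is_derive_eq; rewrite /dg /GRing.scale /=; ring.
have [c /andP[xc cr] E] := MVT_continuous xr dgE.
suff : 0 <= dg c * (r - x) by rewrite -E /g; lra.
apply: mulr_ge0; last lra.
rewrite /dg.
have -> : 2 * (expR c - expR (- c)) * (expR c + expR (- c)) =
    2 * (expR (2 * c) - expR (- (2 * c))).
  by rewrite -mulrN !(mulrC 2 (_ : R)) !expRM_natr; ring.
have : 0 <= 2 * c by lra.
by move=> /expRB_expRN_ge; lra.
Qed.

(* With [x = r cos t / 2] and [y = r sin t / 2], both sides squared and divided
   by [4 e^(2x)] read [sinh^2 x + sin^2 y <= sinh^2 (r / 2)], where
   [x^2 + y^2 = (r / 2)^2]. *)
Lemma normc_cexpB1_le (r t : R) : 0 < r ->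
  normc (cexp r 0 t - 1) <= (expR r - 1) * expR (- (r / 2 * (1 - cos t))).
Proof.
move=> r0.
have E1 : 0 <= expR r - 1 by rewrite subr_ge0 -expR0 ler_expR ltW.
rewrite -[leRHS]ger0_norm ?mulr_ge0 ?expR_ge0 // -sqrtr_sqr.
apply: ler_wsqrtr.
set x := r / 2 * cos t; set y := r / 2 * sin t.
have xy : x ^+ 2 + y ^+ 2 = (r / 2) ^+ 2.
  by rewrite !exprMn -mulrDr cos2Dsin2 mulr1.
have xr : `|x| <= r / 2.
  rewrite normrM ger0_norm; last lra.
  by rewrite ler_piMr ?cos_max //; lra.
(* When these two bounds are added, the quadratic terms cancel by [xy]. *)
have := sqr_expRB_expRN_le xr; have := sqr_sin_le y.
have p0 : expR x != 0 by rewrite gt_eqF ?expR_gt0.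
have q0 : expR (r / 2) != 0 by rewrite gt_eqF ?expR_gt0.
rewrite /expcos /expsin mul0r addr0 oppr0 addr0.
have -> : r * cos t = x * 2 by rewrite /x; lra.
have -> : r * sin t = y *+ 2 by rewrite /y mulr2n; lra.
have -> : - (r / 2 * (1 - cos t)) = x - r / 2 by rewrite /x; lra.
have -> : expR r = expR (r / 2) ^+ 2 by rewrite -expRM_natr divfK // pnatr_eq0.
rewrite expRM_natr cos_mulr2n sin_mulr2n expRB !expRN.
set p := expR x in p0 *; set q := expR (r / 2) in q0 *.
move=> h1 h2; have c2 := cos2Dsin2 y.
have -> : (p ^+ 2 * (cos y ^+ 2 *+ 2 - 1) - 1) ^+ 2 +
    (p ^+ 2 * ((cos y * sin y) *+ 2)) ^+ 2 =
    p ^+ 2 * ((p - p^-1) ^+ 2 + 4 * sin y ^+ 2).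
  rewrite (_ : (p ^+ 2 * (cos y * sin y *+ 2)) ^+ 2 = 4 * p ^+ 4 * cos y ^+ 2 * sin y ^+ 2).
    by rewrite !(cos2sin2 y); field.
  by ring.
have -> : ((q ^+ 2 - 1) * (p / q)) ^+ 2 = p ^+ 2 * (q - q^-1) ^+ 2 by field.
by rewrite ler_wpM2l ?sqr_ge0 //; lra.
Qed.

(** Coefficient extraction from (e^z - 1)^k, the exponential generating function of surjections onto
    a [k]-set, on the circle of radius [r]. *)
Lemma circ_int_num_surj (r : R) (k m : nat) :
  circ_int (fun t => Re ((cexp r 0 t - 1) ^+ k * cexp 0 (- m%:R) t)) =
  2 * pi * r ^+ m / m`!%:R * (num_surj m k)%:R.
Proof.
have -> : (fun t => Re ((cexp r 0 t - 1) ^+ k * cexp 0 (- m%:R) t)) =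
    (fun t => \sum_(j < k.+1) (-1) ^+ (k - j) * 'C(k, j)%:R *
       expcos (j%:R * r) (- m%:R) t).
  apply/funext => t; rewrite addrC exprDn mulr_suml.
  rewrite (raddf_sum (@Re R : Rcomplex R -> R)); apply: eq_bigr => j _.
  rewrite cexpX mulr0 (mulrnAl (_ ^+ _ * _)) -[X in X *+ _]mulrA cexpM add0r addr0.
  have -> : (-1) ^+ (k - j) = ((-1) ^+ (k - j) : R)%:C%C :> R[i].
    by rewrite rmorphXn rmorphN1.
  rewrite -mulr_natl -(rmorph_nat (real_complex R)) /=.
  by rewrite !(mul0r, mulr0, subr0, addr0) /=; ring.
rewrite circ_int_sum => [|j t]; last first.
  by apply: cvgM; [exact: cvg_cst|exact: continuous_expcos].
rewrite num_surjE mulr_sumr; apply: eq_bigr => j _.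
rewrite circ_intZ; last exact: continuous_expcos.
by rewrite circ_int_expcosN exprMn; ring.
Qed.

End Surjections.

(** * Asymptotics *)

Section Asymptotics.
Variable R : realType.
Import ComplexField.Normc.

(** This is 2 pi sqrt n times the mass at [n] of the Poisson law of mean [n]; its limit sqrt (2 pi)
    is Stirling's formula. *)
Definition stirling_ratio (n : nat) : R :=
  Num.sqrt n%:R * (expR (- n%:R) * (2 * pi * n%:R ^+ n / n`!%:R)).

Lemma cvg_stirling_ratio : stirling_ratio k.+1 @[k --> \oo] --> Num.sqrt (pi / 2^-1 : R).
Proof.
(* A Poisson variable of mean [k.+1] is a sum of [k.+1] independent ones of mean 1, here centred, of
   variance 1 = 2 * 2^-1. The rate [8^-1] comes from [one_sub_cos_ge]. *)
have := @laplace_cexp R (expR (-1)) 0 1 (-1) 2^-1 8^-1 0.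
have e1 : expR (- 1) * expR 1 = 1 :> R by rewrite -expRD addNr expR0.
have -> : (fun k : nat => Num.sqrt k.+1%:R * circ_int (fun t => Re (((expR (- 1))%:C%C *
    cexp 1 (- 1) t + 0%:C%C * cexp 0 (- 1) t) ^+ k.+1 * cexp 0 0 t))) =
    (fun k => stirling_ratio k.+1).
  apply/funext => k; congr (_ * _).
  rewrite -[X in _ = expR X * _]mulN1r expRM_natr -circ_int_expcosN -circ_intZ; last first.
    exact: continuous_expcos.
  apply: eq_Rintegral => t _; rewrite rmorph0 mul0r addr0 cexp00 mulr1.
  rewrite exprMn -rmorphXn cexpX /= mul0r subr0.
  by rewrite mulr1 mulrN1.
apply; rewrite ?e1; try lra.
move=> t tpi; rewrite rmorph0 mul0r addr0 normcM normc_cexp normc_real.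
rewrite ger0_norm ?expR_ge0 // -expRD ler_expR.
by have := one_sub_cos_ge tpi; lra.
Qed.

(** * The Poisson law conditioned to be positive *)

Section Peak.
Variable r : R.
Hypothesis r_gt0 : 0 < r.

Let E := expR r - 1.
(* Mean and half variance of a Poisson law of parameter [r] conditioned to be
   positive. *)
Definition tp_mean : R := r * expR r / (expR r - 1).
Definition tp_hvar : R := tp_mean * (1 + r - tp_mean) / 2.

Let E_gt0 : 0 < E.
Proof. by rewrite subr_gt0 expR_gt1. Qed.

Let E_neq0 : expR r - 1 != 0.
Proof. by rewrite gt_eqF. Qed.

Lemma tp_mean_gt0 : 0 < tp_mean.
Proof. by rewrite /tp_mean divr_gt0 // mulr_gt0 // expR_gt0. Qed.

Lemma tp_mean_lt : tp_mean < 1 + r.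
Proof.
rewrite /tp_mean ltr_pdivrMr //.
have : 1 + r < expR r by apply: expR_gt1Dx; rewrite gt_eqF.
by rewrite mulrDl mul1r mulrBr; lra.
Qed.

Lemma tp_hvar_gt0 : 0 < tp_hvar.
Proof. by rewrite divr_gt0 // mulr_gt0 ?tp_mean_gt0 // subr_gt0 tp_mean_lt. Qed.

(* [surj_peak i k / (2 pi)] is the value at [i] below the mean of the density of
   the sum of [k] independent copies of that law, when the mean is an integer. *)
Definition surj_peak (i k : nat) : R := circ_int (fun t =>
  Re ((E^-1%:C%C * cexp r (- tp_mean) t + (- E^-1)%:C%C * cexp 0 (- tp_mean) t) ^+ k
      * cexp 0 i%:R t)).

Lemma cvg_surj_peak i :
  Num.sqrt k.+1%:R * surj_peak i k.+1 @[k --> \oo] --> Num.sqrt (pi / tp_hvar).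
Proof.
(* The rate [r / 16] is the factor [r / 2] of [normc_cexpB1_le] times the [1 / 8] of
   [one_sub_cos_ge]. *)
apply: (@laplace_cexp R E^-1 (- E^-1) r (- tp_mean) tp_hvar (r / 16)).
- exact: tp_hvar_gt0.
- by rewrite divr_gt0.
- by rewrite /E; field.
- by rewrite /E /tp_mean; field.
- by rewrite /tp_hvar /E /tp_mean; field.
move=> t tpi.
have -> : E^-1%:C%C * cexp r (- tp_mean) t + (- E^-1)%:C%C * cexp 0 (- tp_mean) t =
    E^-1%:C%C * ((cexp r 0 t - 1) * cexp 0 (- tp_mean) t).
  by rewrite rmorphN mulrBl cexpM addr0 add0r mul1r; ring.
rewrite !normcM normc_cexp mul0r expR0 mulr1 normc_real ger0_norm; last first.
  by rewrite invr_ge0 ltW.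
rewrite mulrC ler_pdivrMr //; apply: (le_trans (normc_cexpB1_le t r_gt0)).
rewrite mulrC ler_wpM2r ?(ltW E_gt0) // ler_expR.
have := one_sub_cos_ge tpi => h.
have : 0 <= r * (1 - cos t - t ^+ 2 / 8) by rewrite mulr_ge0 ?(ltW r_gt0) //; lra.
by lra.
Qed.

(** Since [k%:R * tp_mean = n%:R], the centring and the shift by [i] combine into the integer
    frequency [- (n - i)%:R], which extracts a coefficient. *)
Lemma surj_peakE i k n : k%:R * tp_mean = n%:R -> (i <= n)%N ->
  surj_peak i k =
  E ^- k * (2 * pi * r ^+ (n - i) / (n - i)`!%:R * (num_surj (n - i) k)%:R).
Proof.
move=> kn ni; rewrite -circ_int_num_surj -circ_intZ; last first.
  suff [] : ccontinuous (fun t => (cexp r 0 t - 1) ^+ k * cexp 0 (- (n - i)%:R) t) by [].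
  apply: ccontinuousM; last exact: ccontinuous_cexp.
  apply: ccontinuousX; apply: ccontinuousD; first exact: ccontinuous_cexp.
  exact: ccontinuous_cst.
apply: eq_Rintegral => t _.
have -> : E^-1%:C%C * cexp r (- tp_mean) t + (- E^-1)%:C%C * cexp 0 (- tp_mean) t =
    E^-1%:C%C * ((cexp r 0 t - 1) * cexp 0 (- tp_mean) t).
  by rewrite rmorphN mulrBl cexpM addr0 add0r mul1r; ring.
rewrite !exprMn -!mulrA cexpX mulr0 cexpM addr0 mulrN kn natrB // opprB (addrC (- n%:R)).
rewrite -rmorphXn exprVn; case: (_ * cexp _ _ _) => x y /=.
by rewrite mul0r subr0.
Qed.

End Peak.

(** * Limits of the coefficients and of sums of growing length *)

Lemma cvg_ffact_ratio i : (n ^_ i)%:R / n%:R ^+ i @[n --> \oo] --> (1 : R).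
Proof.
elim: i => [|i IH].
  under eq_fun do rewrite ffactn0 expr0 divr1; exact: cvg_cst.
have h : 1 - i%:R * n%:R^-1 @[n --> \oo] --> (1 : R).
  rewrite -[X in _ --> X]subr0; apply: cvgB; first exact: cvg_cst.
  rewrite -[X in _ --> X](mulr0 i%:R); apply: cvgM; first exact: cvg_cst.
  apply/gtr0_cvgV0; first by near do rewrite ltr0n; exists 1%N.
  exact: cvgr_idn.
have H : (n ^_ i)%:R / n%:R ^+ i * (1 - i%:R * n%:R^-1) @[n --> \oo] --> (1 : R).
  by rewrite -[X in _ --> X]mulr1; exact: cvgM.
apply: cvg_trans H; apply: near_eq_cvg; near=> n.
have n0 : n%:R != 0 :> R.
  by rewrite pnatr_eq0 -lt0n; near: n; exists 1%N.
have ni : (i <= n)%N by near: n; exists i.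
rewrite /= ffactnSr natrM natrB // exprSr; field.
by rewrite n0 expf_neq0.
Unshelve. all: by end_near. Qed.

Lemma cvg_stirling1 i :
  (stirling1 n i)%:R / n%:R ^+ (2 * i) @[n --> \oo] --> ((2 ^+ i * i`!%:R)^-1 : R).
Proof.
have c0 : 0 < 2 ^+ i * i`!%:R :> R by rewrite mulr_gt0 ?exprn_gt0 // ltr0n fact_gt0.
apply: (@squeeze_cvgr _ _ _ _
  (fun n => (2 ^+ i * i`!%:R)^-1 * ((n ^_ (2 * i))%:R / n%:R ^+ (2 * i)))
  (cst (2 ^+ i * i`!%:R)^-1)).
- near=> n; have n0 : 0 < n%:R :> R by rewrite ltr0n; near: n; exists 1%N.
  have n0' : 0 < n%:R ^+ (2 * i) :> R by rewrite exprn_gt0.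
  apply/andP; split.
    rewrite mulrA ler_wpM2r ?invr_ge0 ?(ltW n0') // ler_pdivrMl //.
    by rewrite -natrX -!natrM ler_nat stirling1_lb.
  rewrite ler_pdivrMr // ler_pdivlMl //.
  by rewrite -!natrX -!natrM ler_nat stirling1_ub.
- rewrite -[X in _ --> X]mulr1; apply: cvgM; first exact: cvg_cst.
  exact: cvg_ffact_ratio.
- exact: cvg_cst.
Unshelve. all: by end_near. Qed.

(** Dominated convergence for sums: a fixed number [N] of terms converges termwise, and the rest is
    bounded by a tail of [series g]. The filter is general so that [n] can be restricted to
    admissible values. *)
Lemma tannery (F : set_system nat) (FF : Filter F) (b : nat -> nat -> R)
    (beta g : nat -> R) (l : R) :
  F --> \oo -> (forall i, b n i @[n --> F] --> beta i) ->
  (\forall n \near F, forall i, (i <= n)%N -> `|b n i| <= g i) ->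
  cvgn (series g) -> series beta @ \oo --> l ->
  \sum_(i < n.+1) b n i @[n --> F] --> l.
Proof.
move=> Foo bcvg bg gcvg betal.
apply/cvgrPdist_le => e e0.
have e4 : 0 < e / 4 by lra.
(* The cut [N] makes the tails of [series g] and of [series beta] at most [e / 4] each; the head
   will cost another [e / 4]. *)
have [N [gN bN]] : exists N, (forall m, (N <= m)%N ->
    `|series g m - series g N| <= e / 4) /\ `|l - series beta N| <= e / 4.
  have e8 : 0 < e / 8 by lra.
  have [N1 _ h1] := (cvgrPdist_le _ _).1 gcvg _ e8.
  have [N2 _ h2] := (cvgrPdist_le _ _).1 betal _ e4.
  exists (maxn N1 N2); split; last by apply: h2; rewrite /= leq_maxr.
  move=> m Nm; have := h1 m; have := h1 (maxn N1 N2); rewrite /= leq_maxl.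
  rewrite (leq_trans (leq_maxl N1 N2) Nm) => /(_ isT) a1 /(_ isT) a2.
  rewrite (_ : _ - _ = (limn (series g) - series g (maxn N1 N2)) -
     (limn (series g) - series g m)); last by ring.
  by apply: (le_trans (ler_normB _ _)); lra.
have sN : \sum_(0 <= i < N) b n i @[n --> F] --> series beta N.
  by apply: cvg_big => //; exact: add_continuous.
near=> n.
have nN : (N <= n.+1)%N by near: n; apply: Foo; exists N => // n /= /leqW.
rewrite -(big_mkord xpredT (b n)) (big_cat_nat (leq0n N) nN) //=.
rewrite (_ : _ - _ = (l - series beta N) + (series beta N - \sum_(0 <= i < N) b n i)
   - \sum_(N <= i < n.+1) b n i); last by ring.
have h1 : `|series beta N - \sum_(0 <= i < N) b n i| <= e / 4.
  by near: n; move/cvgrPdist_le: sN; apply.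
have h2 : `|\sum_(N <= i < n.+1) b n i| <= e / 4.
  apply: (le_trans (ler_norm_sum _ _ _)).
  apply: (@le_trans _ _ (\sum_(N <= i < n.+1) g i)).
    rewrite big_nat_cond [leRHS]big_nat_cond; apply: ler_sum => i /andP[/andP[_ ni] _].
    have : forall i, (i <= n)%N -> `|b n i| <= g i by near: n.
    by apply; rewrite -ltnS.
  have := gN _ nN; rewrite !seriesEnat /= (big_cat_nat (leq0n N) nN) //= addrAC subrr add0r.
  by apply: le_trans; exact: ler_norm.
apply: (le_trans (ler_normB _ _)).
apply: (le_trans (lerD (ler_normD _ _) (lexx _))).
by lra.
Unshelve. all: by end_near. Qed.

(** * Asymptotics of surjection numbers near the diagonal ratio prescribed by [sigma] *)

Section SurjectionAsymptotics.
Variable sigma : R.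
Hypothesis sigma_gt0 : 0 < sigma.

Let r := 1 / sigma.
Let q := expR (- r).

Let r_gt0 : 0 < r. Proof. by rewrite divr_gt0. Qed.

Let r_neq0 : r != 0. Proof. by rewrite gt_eqF. Qed.

Let q_lt1 : 0 < 1 - q.
Proof. by rewrite subr_gt0 -expR0 ltr_expR oppr_lt0. Qed.

Let expr_q : expR r = q^-1. Proof. by rewrite /q expRN invrK. Qed.

Let q_neq0 : q != 0. Proof. by rewrite gt_eqF ?expR_gt0. Qed.

Let q_neq1 : 1 - q != 0. Proof. by rewrite gt_eqF. Qed.

Lemma tp_meanE : tp_mean r = r / (1 - q).
Proof. by rewrite /tp_mean expr_q; field; rewrite q_neq0 q_neq1. Qed.

(** The three factors come from Laplace's method, from sqrt (n / k), and from Stirling's formula for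
    [n!]. *)
Lemma vE : v sigma = Num.sqrt (pi / tp_hvar r) * Num.sqrt (tp_mean r) /
  Num.sqrt (pi / 2^-1).
Proof.
have pi0 := pi_gt0 R.
have h0 := tp_hvar_gt0 r_gt0; have m0 := tp_mean_gt0 r_gt0.
rewrite -sqrtrV ?divr_ge0 ?pi_ge0 // -!sqrtrM; last 2 first.
- by apply: mulr_ge0; [apply: divr_ge0|]; apply: ltW.
- by apply: divr_ge0; apply: ltW.
congr Num.sqrt; rewrite -/r -/q.
have sr : sigma = r^-1 by rewrite /r div1r invrK.
have m1 := tp_mean_lt r_gt0.
rewrite /tp_hvar tp_meanE sr.
move: m1; rewrite tp_meanE ltr_pdivrMr // => m1.
have d1 : (1 + r) * (1 - q) - r != 0 by rewrite gt_eqF // subr_gt0.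
move: pi pi0 => p p0; have pN : p != 0 by rewrite gt_eqF.
by field; rewrite pN q_neq1 d1 r_neq0.
Qed.

Lemma v_gt0 : 0 < v sigma.
Proof.
rewrite vE; apply: divr_gt0; last by rewrite sqrtr_gt0 divr_gt0 ?pi_gt0 ?invr_gt0.
by apply: mulr_gt0; rewrite sqrtr_gt0 ?tp_mean_gt0 // divr_gt0 ?pi_gt0 ?tp_hvar_gt0.
Qed.

(** Follows from e^r - 1 = (1 - q) e^r and k r = n - n q; the right side contains the powers that
    appear in [surj_peakE] and [stirling_ratio]. *)
Lemma expR_w (n k : nat) : k%:R = n%:R * sigma * (1 - q) ->
  expR (n%:R * w sigma) = (expR r - 1) ^+ k * sigma ^+ n * expR (- n%:R).
Proof.
move=> kn.
have -> : expR r - 1 = (1 - q) * expR r by rewrite expr_q; field.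
have -> : n%:R * w sigma = k%:R * ln (1 - q) + n%:R * ln sigma + (- (n%:R * q)).
  by rewrite /w -/r -/q kn; ring.
rewrite !expRD !expRM_natl !lnK ?posrE // exprMn -(expRM_natl k r).
have -> : k%:R * r = n%:R + - (n%:R * q).
  rewrite kn (_ : r = sigma^-1) ?/r ?div1r // mulrAC mulfK ?gt_eqF //; ring.
rewrite expRD; set x := expR (- (n%:R * q)).
have : expR n%:R * expR (- n%:R) = 1 :> R by rewrite -expRD subrr expR0.
set y := expR n%:R; set z := expR (- n%:R) => yz.
by transitivity ((1 - q) ^+ k * sigma ^+ n * x * (y * z)); [rewrite yz mulr1|ring].
Qed.

Variables (k : nat -> nat) (F : set_system nat).
Context {FF : Filter F}.
Hypothesis Foo : F --> \oo.
Hypothesis kF : \forall n \near F, (k n)%:R = n%:R * sigma * (1 - q).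

(** The Laplace limits are indexed by successors, hence the composition with a predecessor. *)
Let cvg_k : (k n).-1 @[n --> F] --> \oo.
Proof.
apply/cvgnyPge => N; near=> n.
rewrite -ltnS (leq_trans _ (leqSpred _)) // -(ltr_nat R) (near kF n) //.
rewrite -mulrA -ltr_pdivrMr ?mulr_gt0 //.
by near: n; apply: Foo; exact: nbhs_infty_gtr.
Unshelve. all: by end_near. Qed.

Let cvg_pred : n.-1 @[n --> F] --> \oo.
Proof.
apply/cvgnyPge => N; near=> n.
rewrite -ltnS (leq_trans _ (leqSpred _)) //.
by near: n; apply: Foo; exact: nbhs_infty_gt.
Unshelve. all: by end_near. Qed.

Lemma cvg_num_surj i :
  n%:R ^+ i * (num_surj (n - i) (k n))%:R /
    (n%:R ^+ n * expR (n%:R * w sigma) * v sigma) @[n --> F] --> r ^+ i.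
Proof.
have m0 := tp_mean_gt0 r_gt0.
have cL := cvg_comp _ _ cvg_k (cvg_surj_peak r_gt0 i).
have cP := cvg_comp _ _ cvg_pred cvg_stirling_ratio.
have cR := cvg_comp _ _ Foo (cvg_ffact_ratio i).
have P0 : Num.sqrt (pi / 2^-1) != 0 :> R.
  by rewrite gt_eqF // sqrtr_gt0 divr_gt0 ?pi_gt0 ?invr_gt0.
(* This product of known limits equals the ratio of the statement for large [n]: [stirling_ratio]
   brings in [n!], and [n ^_ i] reduces it to [(n - i)!]. *)
have H : Num.sqrt (k n).-1.+1%:R * surj_peak r i (k n).-1.+1 / stirling_ratio n.-1.+1 *
    Num.sqrt (tp_mean r) / ((n ^_ i)%:R / n%:R ^+ i) * r ^+ i / v sigma
    @[n --> F] --> r ^+ i.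
  have E : r ^+ i = Num.sqrt (pi / tp_hvar r) / Num.sqrt (pi / 2^-1) *
      Num.sqrt (tp_mean r) / 1 * r ^+ i / v sigma.
    have aN : Num.sqrt (pi / tp_hvar r) != 0.
      by rewrite gt_eqF // sqrtr_gt0 divr_gt0 ?pi_gt0 ?tp_hvar_gt0.
    have bN : Num.sqrt (tp_mean r) != 0 by rewrite gt_eqF // sqrtr_gt0.
    rewrite vE; move: aN bN P0; move: (Num.sqrt _) (Num.sqrt _) (Num.sqrt _).
    by move=> a b c aN bN cN; field; rewrite aN bN cN.
  rewrite [X in _ --> X]E; apply: cvgM; last exact: cvg_cst.
  apply: cvgM; last exact: cvg_cst.
  apply: cvgM; last by apply: cvgV => //; exact: cR.
  apply: cvgM; last exact: cvg_cst.
  by apply: cvgM; [exact: cL|apply: cvgV => //; exact: cP].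
apply: cvg_trans H; apply: near_eq_cvg; near=> n.
have n0 : (0 < n)%N by near: n; apply: Foo; exact: nbhs_infty_gt.
have ni : (i <= n)%N by near: n; apply: Foo; exact: nbhs_infty_ge.
have nR : 0 < n%:R :> R by rewrite ltr0n.
have kn : (k n)%:R = n%:R * sigma * (1 - q) by near: n.
have kR : 0 < (k n)%:R :> R by rewrite kn !mulr_gt0.
have k0 : (0 < k n)%N by rewrite -(ltr_nat R).
have kmu : (k n)%:R * tp_mean r = n%:R.
  rewrite kn tp_meanE /r; field; rewrite q_neq1 gt_eqF //.
rewrite !prednK // (surj_peakE kmu ni) (expR_w kn) /stirling_ratio.
have -> : Num.sqrt n%:R = Num.sqrt (k n)%:R * Num.sqrt (tp_mean r) :> R.
  by rewrite -sqrtrM ?(ltW kR) // kmu.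
rewrite -(ffact_fact ni) natrM.
have -> : sigma ^+ n = (r ^+ (n - i) * r ^+ i)^-1.
  by rewrite -exprD subnK // -exprVn /r div1r invrK.
have vN : v sigma != 0 by rewrite gt_eqF // v_gt0.
have xN : Num.sqrt (k n)%:R != 0 :> R by rewrite gt_eqF // sqrtr_gt0.
have yN : Num.sqrt (tp_mean r) != 0 by rewrite gt_eqF // sqrtr_gt0.
have eN : (expR r - 1) ^+ k n != 0 by rewrite expf_neq0 // subr_eq0 gt_eqF // expR_gt1.
have zN : expR (- n%:R) != 0 :> R by rewrite gt_eqF // expR_gt0.
have pN : pi != 0 :> R by rewrite gt_eqF // pi_gt0.
have aN : (n ^_ i)%:R != 0 :> R by rewrite pnatr_eq0 -lt0n ffact_gt0.
have fN : ((n - i)`!)%:R != 0 :> R by rewrite pnatr_eq0 -lt0n fact_gt0.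
have NN : n%:R ^+ n != 0 :> R by rewrite expf_neq0 // gt_eqF.
have NiN : n%:R ^+ i != 0 :> R by rewrite expf_neq0 // gt_eqF.
have rN : r ^+ (n - i) != 0 by rewrite expf_neq0.
have riN : r ^+ i != 0 by rewrite expf_neq0.
move: vN xN yN eN zN pN aN fN NN NiN rN riN.
move: (v sigma) (Num.sqrt _) (Num.sqrt _) ((expR r - 1) ^+ k n) (expR _) pi
  (n ^_ i)%:R ((n - i)`!)%:R (n%:R ^+ n) (n%:R ^+ i) (r ^+ (n - i)) (r ^+ i).
move=> vv x y e z p a f nn nI rni ri vN xN yN eN zN pN aN fN NN NiN rN riN.
by field; rewrite vN xN yN eN zN pN aN fN NN NiN rN riN.
Unshelve. all: by end_near. Qed.

(** As n = [tp_mean r] * k, the power n^i splits off k^i, which [num_surj_leX] absorbs; what remains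
    is the case i = 0, whose limit 1 is eventually below 2. The bound is thus uniform in [i]. *)
Lemma near_num_surj_le : \forall n \near F, forall i, (i <= n)%N ->
  0 <= n%:R ^+ i * (num_surj (n - i) (k n))%:R /
    (n%:R ^+ n * expR (n%:R * w sigma) * v sigma) <= 2 * tp_mean r ^+ i.
Proof.
have m0 := tp_mean_gt0 r_gt0.
have c0 : \forall n \near F, (num_surj n (k n))%:R /
    (n%:R ^+ n * expR (n%:R * w sigma) * v sigma) <= 2.
  have h : (num_surj n (k n))%:R / (n%:R ^+ n * expR (n%:R * w sigma) * v sigma)
      @[n --> F] --> (1 : R).
    have := @cvg_num_surj 0%N; rewrite expr0.
    by under eq_fun do rewrite expr0 mul1r subn0.
  by apply: cvgr_le h _ _; rewrite ltr1n.
near=> n => i ni.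
have kn : (k n)%:R = n%:R * sigma * (1 - q) by near: n.
have kmu : n%:R = tp_mean r * (k n)%:R.
  by rewrite kn tp_meanE /r; field; rewrite q_neq1 gt_eqF.
set T := _ * v sigma.
have T0 : 0 <= T by rewrite !mulr_ge0 ?exprn_ge0 ?expR_ge0 // ltW ?v_gt0.
apply/andP; split; first by rewrite divr_ge0 // mulr_ge0 ?exprn_ge0.
rewrite {1}kmu exprMn mulrC -!mulrA mulrCA mulrC ler_wpM2r ?exprn_ge0 ?(ltW m0) //.
apply: (@le_trans _ _ ((num_surj n (k n))%:R / T)).
  rewrite mulrC ler_wpM2r ?invr_ge0 // -natrX -natrM ler_nat.
  by rewrite (leq_trans (num_surj_leX _ _ _)) // subnKC.
by rewrite /T; near: n.
Unshelve. all: by end_near. Qed.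

End SurjectionAsymptotics.

End Asymptotics.

(* m_kl(n) is only defined for integers k and l, so n tends to infinity
   through those n for which k(n) and l(n) have the prescribed values. *)
Theorem theorem2 (R : realType) (sigma tau : R) (k l : nat -> nat)
    (sigma_gt0 : 0 < sigma) (tau_gt0 : 0 < tau) :
  (num_incidence (k n) (l n) n)%:R /
    (n%:R ^+ (2 * n) / (n`!)%:R
     * expR (n%:R * w sigma) * v sigma
     * expR (n%:R * w tau) * v tau
     * expR (- (1 / (2 * sigma * tau))))
  @[n --> within [set n : nat |
        (k n)%:R = n%:R * sigma * (1 - expR (- (1 / sigma))) /\
        (l n)%:R = n%:R * tau * (1 - expR (- (1 / tau)))] \oo] --> (1 : R).
Proof.
set F := within _ _; have FF : Filter F by exact: within_filter.
have Foo : F --> \oo by exact: cvg_within.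
have kF : \forall n \near F, (k n)%:R = n%:R * sigma * (1 - expR (- (1 / sigma))).
  by apply: filterS (withinT _ _) => n [].
have lF : \forall n \near F, (l n)%:R = n%:R * tau * (1 - expR (- (1 / tau))).
  by apply: filterS (withinT _ _) => n [].
pose T (x : R) n := n%:R ^+ n * expR (n%:R * w x) * v x.
pose X (x : R) (c : nat -> nat) n i :=
  n%:R ^+ i * (num_surj (n - i) (c n))%:R / T x n.
(* The power n^(2i) divided out of the Stirling number is returned as n^i in each of the two [X]
   factors. *)
pose b n i := (-1) ^+ i * ((stirling1 n i)%:R / n%:R ^+ (2 * i)) *
  X sigma k n i * X tau l n i.
pose la := 1 / (2 * sigma * tau).
(* The bounds 1 / (2^i i!) on the Stirling factor and [2 * tp_mean _ ^+ i] on each [X] multiply to 4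
   M^i / i!. *)
pose M := tp_mean (1 / sigma) * tp_mean (1 / tau) / 2.
have sN : sigma != 0 by rewrite gt_eqF.
have tN : tau != 0 by rewrite gt_eqF.
have f0 i : i`!%:R != 0 :> R by rewrite pnatr_eq0 -lt0n fact_gt0.
have bcvg : \sum_(i < n.+1) b n i @[n --> F] --> expR (- la).
  apply: (@tannery _ _ _ _ (exp_coeff (- la)) (fun i => 4 * exp_coeff M i)) => //.
  - move=> i; have -> : exp_coeff (- la) i = (-1) ^+ i * (2 ^+ i * i`!%:R)^-1 *
        (1 / sigma) ^+ i * (1 / tau) ^+ i.
      rewrite /exp_coeff /= (_ : - la = -1 * 2^-1 * (1 / sigma) * (1 / tau)).
        by rewrite !exprMn exprVn invfM; ring.
      by rewrite /la; field; rewrite sN tN.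
    apply: cvgM; last exact: cvg_num_surj.
    apply: cvgM; last exact: cvg_num_surj.
    apply: cvgM; first exact: cvg_cst.
    by move=> A /(@cvg_stirling1 R i); exact: Foo.
  - near=> n => i ni.
    have n0 : 0 < n%:R :> R.
      by rewrite ltr0n; near: n; apply: Foo; exact: nbhs_infty_gt.
    have /(_ i ni)/andP[X0 X1] : forall j, (j <= n)%N ->
        0 <= X sigma k n j <= 2 * tp_mean (1 / sigma) ^+ j.
      by near: n; exact: near_num_surj_le.
    have /(_ i ni)/andP[Y0 Y1] : forall j, (j <= n)%N ->
        0 <= X tau l n j <= 2 * tp_mean (1 / tau) ^+ j.
      by near: n; exact: near_num_surj_le.
    have s0 : 0 <= (stirling1 n i)%:R / n%:R ^+ (2 * i) :> R.
      by rewrite divr_ge0 ?exprn_ge0.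
    have s1 : (stirling1 n i)%:R / n%:R ^+ (2 * i) <= (2 ^+ i * i`!%:R)^-1 :> R.
      rewrite ler_pdivrMr ?exprn_gt0 // ler_pdivlMl ?mulr_gt0 ?exprn_gt0 ?ltr0n ?fact_gt0 //.
      by rewrite -!natrX -!natrM ler_nat stirling1_ub.
    rewrite /b -!(mulrA ((-1) ^+ i)) normrM normrX normrN1 expr1n mul1r ger0_norm; last first.
      by apply: mulr_ge0 => //; apply: mulr_ge0.
    have -> : 4 * exp_coeff M i = (2 ^+ i * i`!%:R)^-1 *
        ((2 * tp_mean (1 / sigma) ^+ i) * (2 * tp_mean (1 / tau) ^+ i)).
      rewrite /exp_coeff /= /M; move: (tp_mean _) (tp_mean _) => x y.
      by rewrite !exprMn exprVn invfM; ring.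
    by rewrite [leRHS]mulrA; apply: ler_pM => //; [apply: mulr_ge0|apply: ler_pM].
  - exact: is_cvg_seriesZ (is_cvg_series_exp_coeff M).
  - exact: is_cvg_series_exp_coeff.
have e0 : expR (- la) != 0 by rewrite gt_eqF // expR_gt0.
have H : (\sum_(i < n.+1) b n i) / expR (- la) @[n --> F] --> (1 : R).
  by rewrite -[X in _ --> X](divff e0); apply: cvgM => //; exact: cvg_cst.
apply: cvg_trans H; apply: near_eq_cvg; near=> n.
have n0 : 0 < n%:R :> R.
  by rewrite ltr0n; near: n; apply: Foo; exact: nbhs_infty_gt.
(* For n > 0 this is the exact enumeration formula divided by both normalisations; only algebra
   separates it from the stated ratio. *)
have -> : \sum_(i < n.+1) b n i =
    (n`!%:R * (num_incidence (k n) (l n) n)%:R) / (T sigma n * T tau n).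
  rewrite num_incidence_stirling1 mulr_suml; apply: eq_bigr => i _.
  rewrite /b /X mul2n -addnn exprD.
  have nN : n%:R ^+ i != 0 :> R by rewrite expf_neq0 // gt_eqF.
  by rewrite (invfM (T sigma n)); move: (T sigma n)^-1 (T tau n)^-1 => a c; field.
rewrite /T mul2n -addnn exprD -/la.
have := v_gt0 sigma_gt0; have := v_gt0 tau_gt0.
move: (v sigma) (v tau) => v1 v2 /lt0r_neq0 v2N /lt0r_neq0 v1N.
have NN : n%:R ^+ n != 0 :> R by rewrite expf_neq0 // gt_eqF.
have := expR_gt0 (n%:R * w sigma); have := expR_gt0 (n%:R * w tau).
move: (expR (_ * w sigma)) (expR (_ * w tau)) => e1 e2 /lt0r_neq0 e2N /lt0r_neq0 e1N.
have fN := f0 n; move: NN fN e0.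
move: (n%:R ^+ n) (n`!%:R) (expR (- la)) => N f L NN fN LN.
by field; rewrite NN fN LN e1N e2N v1N v2N.
Unshelve. all: by end_near. Qed.
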